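(* $\operatorname{bsr}\mathrm{AP}^+=\operatorname{tsr}\mathrm{AP}^+=\operatorname{bsr}\mathrm{AP}^+_{\mathrm{hol}}=\operatorname{tsr}\mathrm{AP}^+_{\mathrm{hol}}=\infty$.
   Context: $\mathbb{C}^+=\{z\in\mathbb{C}:\operatorname{Im}z>0\}$. $\mathrm{AP}^+$ is the uniform closure in $C_b(\mathbb{R},\mathbb{C})$ (bounded continuous functions on $\mathbb{R}$, supremum norm) of the set of all functions $Q(t)=\sum_{j=1}^n a_je^{i\lambda_jt}$ with $a_j\in\mathbb{C}$, $\lambda_j\ge 0$ real, $n\ge1$. $\mathrm{AP}^+_{\mathrm{hol}}$ is the uniform closure in $C_b(\mathbb{C}^+,\mathbb{C})$ (bounded continuous functions on $\mathbb{C}^+$, supremum norm) of the set of all functions $q(z)=\sum_{j=1}^n a_je^{i\lambda_jz}$ with $a_j\in\mathbb{C}$, $\lambda_j\ge 0$ real, $n\ge1$. Both are commutative unital Banach algebras under pointwise operations. For a commutative unital ring $A$, an $n$-tuple $(f_1,\dots,f_n)\in A^n$ is invertible if there is $(x_1,\dots,x_n)\in A^n$ with $\sum_{j=1}^n x_jf_j=1$; $U_n(A)$ is the set of invertible $n$-tuples. A tuple $(f_1,\dots,f_n,g)\in U_{n+1}(A)$ is reducible if there is $(a_1,\dots,a_n)\in A^n$ with $(f_1+a_1g,\dots,f_n+a_ng)\in U_n(A)$. The Bass stable rank $\operatorname{bsr}A$ is the smallest integer $n\ge1$ such that every element of $U_{n+1}(A)$ is reducible, and $\operatorname{bsr}A=\infty$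 if no such $n$ exists. For a commutative unital Banach algebra $A$, the topological stable rank $\operatorname{tsr}A$ is the least integer $n\ge1$ such that $U_n(A)$ is dense in $A^n$, and $\operatorname{tsr}A=\infty$ if no such $n$ exists. *)

(* Defs.v *)
From HB Require Import structures.
From mathcomp Require Import all_boot all_order all_algebra.
From mathcomp Require Import all_classical all_reals all_analysis.
From mathcomp Require Import complex.

Set Implicit Arguments.
Unset Strict Implicit.
Unset Printing Implicit Defensive.

Import Order.TTheory GRing.Theory Num.Theory.
Import numFieldNormedType.Exports.

Local Open Scope classical_set_scope.
Local Open Scope ring_scope.

(* mathcomp only puts the norm topology on R[i] seen as an abstract
   numClosedFieldType; the instances must be repeated on the concrete type. *)
Section ComplexTopology.
Variable R : rcfType.
#[non_forgetful_inheritance]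
HB.instance Definition _ := GRing.ComAlgebra.copy R[i] R[i]^o.
#[non_forgetful_inheritance]
HB.instance Definition _ := NormedModule.copy R[i] R[i]^o.
End ComplexTopology.

(* Not a Banach algebra structure: HB requires a join of rings and normed
   modules to be declared before numDomainType. The topological stable rank
   depends only on the ring operations and the topology. *)
#[short(type="preTopologicalComRingType")]
HB.structure Definition PreTopologicalComRing :=
  {A of GRing.ComPzRing A & Topological A}.

Section StableRanks.

Definition invertible_tuples (A : comPzRingType) (n : nat) : set 'rV[A]_n :=
  [set f | exists x : 'rV[A]_n, \sum_(j < n) x 0 j * f 0 j = 1].

(* Here h = row_mx f g stands for the tuple (f_1, ..., f_n, g). *)
Definition reducible (A : comPzRingType) (n : nat) (h : 'rV[A]_(n + 1)) : Prop :=
  let f := lsubmx h in let g := rsubmx h 0 0 in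
  exists a : 'rV[A]_n, invertible_tuples (\row_j (f 0 j + a 0 j * g)).

(* The values are extended naturals; -oo is never taken. *)
Definition least_or_infty (P : nat -> Prop) : \bar nat :=
  if pselect (exists n, `[< P n >]) is left exP then (ex_minn exP)%:E else +oo%E.

Definition bsr (A : comPzRingType) : \bar nat :=
  least_or_infty (fun n => (0 < n)%N /\
    forall h : 'rV[A]_(n + 1), invertible_tuples h -> reducible h).

Definition tsr (A : preTopologicalComRingType) : \bar nat :=
  least_or_infty (fun n => (0 < n)%N /\
    dense (@invertible_tuples A n : set 'rV[A]_n)).

End StableRanks.

(* A pointed X makes the ring of functions nontrivial; the point plays no other
   role. *)
Section Cb.
Variables (R : realType) (X : ptopologicalType).

Definition bcont : {pred X -> R[i]} :=
  mem [set f : X -> R[i] | continuous f /\ bounded_fun f].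

Record Cb := MkCb { Cb_fun :> X -> R[i]; _ : Cb_fun \in bcont }.

HB.instance Definition _ := [isSub of Cb for Cb_fun].
HB.instance Definition _ := [Choice of Cb by <:].

End Cb.
Arguments bcont : clear implicits.

Section CbAlgebra.
Variables (R : realType) (X : ptopologicalType).
Local Notation C := R[i].

Lemma bcontP (f : X -> C) :
  reflect (continuous f /\ exists M : C, forall x, `|f x| <= M) (f \in bcont R X).
Proof.
apply: (iffP idP).
  rewrite inE => -[cf [M [Mr fM]]]; split=> //.
  by exists (M + 1) => x; apply: fM => //; rewrite ltrDl.
move=> [cf [M fM]]; rewrite inE; split=> //; exists M; split.
  exact: ger0_real (le_trans (normr_ge0 _) (fM point)).
by move=> N MN x _; apply: le_trans (fM x) (ltW MN).
Qed.

Lemma bcont_submod : submod_closed (bcont R X).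
Proof.
split.
  apply/bcontP; split; first by move=> x; exact: cvg_cst.
  by exists 0 => x; rewrite normr0.
move=> a f g /bcontP[cf [M fM]] /bcontP[cg [N gN]]; apply/bcontP; split.
  move=> x; apply: cvgD; last exact: cg.
  by apply: cvgM; [exact: cvg_cst | exact: cf].
exists (`|a| * M + N) => x; apply: le_trans (ler_normD _ _) _.
by rewrite lerD// normrM ler_wpM2l.
Qed.

Lemma bcont_subring : subring_closed (bcont R X).
Proof.
split.
- apply/bcontP; split; first by move=> x; exact: cvg_cst.
  by exists 1 => x; rewrite normr1.
- move=> f g /bcontP[cf [M fM]] /bcontP[cg [N gN]]; apply/bcontP; split.
    by move=> x; apply: cvgB; [exact: cf | exact: cg].
  by exists (M + N) => x; apply: le_trans (ler_normB _ _) _; rewrite lerD.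
- move=> f g /bcontP[cf [M fM]] /bcontP[cg [N gN]]; apply/bcontP; split.
    by move=> x; apply: cvgM; [exact: cf | exact: cg].
  by exists (M * N) => x; rewrite normrM ler_pM.
Qed.

HB.instance Definition _ :=
  GRing.SubChoice_isSubComNzRing.Build (X -> C) (bcont R X) (Cb R X) bcont_subring.
HB.instance Definition _ :=
  GRing.SubZmodule_isSubLmodule.Build R[i] (X -> C) (bcont R X) (Cb R X) bcont_submod.

Lemma Cb_scaleAl (a : C) (f g : Cb R X) : a *: (f * g) = a *: f * g.
Proof. by apply: val_inj; apply/funext => x /=; rewrite [LHS]mulrA. Qed.

HB.instance Definition _ := GRing.Lmodule_isLalgebra.Build R[i] (Cb R X) Cb_scaleAl.
HB.instance Definition _ := GRing.Lalgebra_isComAlgebra.Build R[i] (Cb R X).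

End CbAlgebra.

Section CbNorm.
Variables (R : realType) (X : ptopologicalType).
Local Notation C := R[i].
Local Open Scope complex_scope.

(* As an R[i]-module, Cb has its norm in R[i], as the library requires; hence
   the embedding of the real supremum. *)
Definition supnorm (f : Cb R X) : C := (sup (range (fun x => complex.Re `|f x|)))%:C.

Lemma ReK_ge0 (z : C) : 0 <= z -> (complex.Re z)%:C = z.
Proof. by case: z => a b; rewrite lecE /= => /andP[/eqP -> _]. Qed.

Lemma supnorm_has_sup (f : Cb R X) : has_sup (range (fun x => complex.Re `|f x|)).
Proof.
have /bcontP[_ [M fM]] := valP f.
split; first by exists (complex.Re `|f point|), point.
exists (complex.Re M) => _ [x _ <-].
by rewrite -lecR !ReK_ge0 ?(le_trans _ (fM x)) ?normr_ge0 //; exact: fM.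
Qed.

Lemma supnorm_ub (f : Cb R X) x : `|f x| <= supnorm f.
Proof.
rewrite -(ReK_ge0 (normr_ge0 (f x))) lecR.
by apply: (sup_upper_bound (supnorm_has_sup f)); exists x.
Qed.

Lemma supnorm_le (f : Cb R X) M : (forall x, `|f x| <= M) -> supnorm f <= M.
Proof.
move=> fM; have M0 : 0 <= M := le_trans (normr_ge0 _) (fM point).
rewrite -(ReK_ge0 M0) lecR; apply: ge_sup; first by exists (complex.Re `|f point|), point.
by move=> _ [x _ <-]; rewrite -lecR !ReK_ge0 ?normr_ge0.
Qed.

Lemma supnormD (f g : Cb R X) : supnorm (f + g) <= supnorm f + supnorm g.
Proof.
apply: supnorm_le => x; apply: le_trans (ler_normD _ _) _.
by rewrite lerD ?supnorm_ub.
Qed.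

Lemma supnormZ (a : C) (f : Cb R X) : supnorm (a *: f) = `|a| * supnorm f.
Proof.
apply/eqP; rewrite eq_le; apply/andP; split.
  by apply: supnorm_le => x; rewrite normrM ler_wpM2l ?supnorm_ub.
have [->|a0] := eqVneq a 0.
  by rewrite normr0 mul0r (le_trans _ (supnorm_ub _ point)).
rewrite -ler_pdivlMl ?normr_gt0//; apply: supnorm_le => x.
by rewrite ler_pdivlMl ?normr_gt0// -normrM (supnorm_ub (a *: f) x).
Qed.

Lemma supnorm_eq0 (f : Cb R X) : supnorm f = 0 -> f = 0.
Proof.
move=> f0; apply/val_inj/funext => x; apply/eqP.
by rewrite -normr_le0 -f0 supnorm_ub.
Qed.

HB.instance Definition _ :=
  Lmodule_isNormed.Build R[i] (Cb R X) supnormD supnormZ supnorm_eq0.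

Lemma Cb_normrM (f g : Cb R X) : `|f * g| <= `|f| * `|g|.
Proof. by apply: supnorm_le => x; rewrite normrM ler_pM ?supnorm_ub. Qed.

End CbNorm.

Section ExpSums.
Variables (R : realType) (X : ptopologicalType) (emb : X -> R[i]).
Local Notation C := R[i].
Local Open Scope complex_scope.

Definition cexp (z : C) : C :=
  (expR (complex.Re z))%:C * (cos (complex.Im z) +i* sin (complex.Im z)).

(* The sums of a_j e^(i l_j z) with l_j >= 0, where z = emb x. With
   0 <= 'Im (emb x), as in both uses below, all such sums are bounded. *)
Definition exp_sums : set (Cb R X) :=
  [set q | exists (n : nat) (a : 'I_n -> C) (l : 'I_n -> R),
    [/\ (0 < n)%N, forall j, 0 <= l j &
      forall x, q x = \sum_(j < n) a j * cexp ('i%C * (l j)%:C * emb x)]].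

Definition ap_pred : {pred Cb R X} := mem (closure exp_sums).

Record AP := MkAP { AP_val : Cb R X; _ : AP_val \in ap_pred }.

HB.instance Definition _ := [isSub of AP for AP_val].
HB.instance Definition _ := [Choice of AP by <:].

Lemma cexp0 : cexp 0 = 1.
Proof. by rewrite /cexp /= expR0 cos0 sin0 mul1r. Qed.

Lemma cexpD z w : cexp (z + w) = cexp z * cexp w.
Proof.
case: z w => [a b] [c d]; rewrite /cexp /= expRD rmorphM /= mulrACA.
congr (_ * _); rewrite cosD sinD; simpc; congr (_ +i* _).
by rewrite addrC.
Qed.

Lemma exp_sums1 : exp_sums 1.
Proof.
exists 1%N, (fun=> 1), (fun=> 0); split=> // x.
by rewrite big_ord1 mul1r mulr0 mul0r cexp0.
Qed.

Lemma exp_sumsZ a f : exp_sums f -> exp_sums (a *: f).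
Proof.
move=> [n [b [l [n0 l0 fE]]]]; exists n, (fun j => a * b j), l; split=> // x.
rewrite -[LHS]/(a * f x) fE mulr_sumr.
by apply: eq_bigr => j _; rewrite mulrA.
Qed.

Lemma exp_sumsD f g : exp_sums f -> exp_sums g -> exp_sums (f + g).
Proof.
move=> [n [a [l [n0 l0 fE]]]] [m [b [k [m0 k0 gE]]]].
pose glue T (u : 'I_n -> T) (v : 'I_m -> T) (i : 'I_(n + m)) :=
  match fintype.split i with inl j => u j | inr j => v j end.
exists (n + m)%N, (glue _ a b), (glue _ l k); split.
- by rewrite addn_gt0 n0.
- by move=> j; rewrite /glue; case: fintype.split.
- move=> x; rewrite -[LHS]/(f x + g x) fE gE big_split_ord /=; congr (_ + _).
    apply: eq_bigr => j _; rewrite /glue.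
    by rewrite -[lshift m j]/(unsplit (inl _ j)) unsplitK.
  apply: eq_bigr => j _; rewrite /glue.
  by rewrite -[rshift n j]/(unsplit (inr _ j)) unsplitK.
Qed.

Lemma exp_sumsM f g : exp_sums f -> exp_sums g -> exp_sums (f * g).
Proof.
move=> [n [a [l [n0 l0 fE]]]] [m [b [k [m0 k0 gE]]]].
have cE : #|{: 'I_n * 'I_m}| = (n * m)%N by rewrite card_prod !card_ord.
pose dec (i : 'I_(#|{: 'I_n * 'I_m}|)) := enum_val i.
exists #|{: 'I_n * 'I_m}|, (fun i => a (dec i).1 * b (dec i).2),
  (fun i => l (dec i).1 + k (dec i).2); split.
- by rewrite cE muln_gt0 n0.
- by move=> j; rewrite addr_ge0.
- move=> x; rewrite -[LHS]/(f x * g x) fE gE big_distrlr /= pair_bigA /=.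
  rewrite (reindex (@enum_val _ {: 'I_n * 'I_m})) /=; last first.
    by apply: onW_bij; exact: enum_val_bij.
  apply: eq_bigr => i _; rewrite rmorphD mulrDr mulrDl cexpD mulrACA.
  by [].
Qed.

Lemma Cb_mul_continuous (f : Cb R X) : continuous (fun h : Cb R X => f * h).
Proof.
move=> h; have FF : Filter (nbhs h) := nbhs_filter h.
apply: (iffRL (@cvgrPdist_lt C (Cb R X) (Cb R X) (nbhs h) _ (fun k => f * k) _)).
move=> e e0; near=> k.
rewrite -mulrBr; apply: le_lt_trans (Cb_normrM _ _) _.
apply: (@le_lt_trans _ _ ((`|f| + 1) * `|h - k|)).
  by rewrite ler_wpM2r// lerDl.
rewrite -ltr_pdivlMl ?ltr_wpDl// mulrC; near: k.
apply/nbhs_ballP; exists (e / (`|f| + 1)); first by rewrite /= divr_gt0 ?ltr_wpDl.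
by move=> k; rewrite -ball_normE.
Unshelve. all: by end_near. Qed.

Lemma closure_stable (F : Cb R X -> Cb R X) : continuous F ->
  (forall f, exp_sums f -> closure exp_sums (F f)) ->
  forall f, closure exp_sums f -> closure exp_sums (F f).
Proof.
move=> cF SF f Sf.
have cl : closed (F @^-1` closure exp_sums).
  by apply: closed_comp => [x _|]; [exact: cF | exact: closed_closure].
by move: (closure_subset SF Sf); rewrite -(closure_id _).1.
Qed.

Lemma ap_subsemi : [/\ ap_pred 1, forall a, {in ap_pred, forall f, a *: f \in ap_pred},
  {in ap_pred &, forall f g, f + g \in ap_pred} &
  {in ap_pred &, forall f g, f * g \in ap_pred}].
Proof.
have S := @subset_closure _ exp_sums.
split.
- by apply/mem_set/S/exp_sums1.
- move=> a f; rewrite !inE -[in a *: f](mul1r f) scalerAl.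
  apply: closure_stable; first exact: Cb_mul_continuous.
  by move=> h Sh; rewrite -scalerAl mul1r; exact/S/exp_sumsZ.
- move=> f g; rewrite !inE => Sf.
  apply: closure_stable.
    by move=> h; apply: (@cvgD _ _ _ (nbhs h)); [exact: cvg_cst | exact: cvg_id].
  move=> h Sh; rewrite addrC; move: f Sf; apply: closure_stable.
    by move=> k; apply: (@cvgD _ _ _ (nbhs k)); [exact: cvg_cst | exact: cvg_id].
  by move=> k Sk; exact/S/exp_sumsD.
- move=> f g; rewrite !inE => Sf.
  apply: closure_stable; first exact: Cb_mul_continuous.
  move=> h Sh; rewrite mulrC; move: f Sf; apply: closure_stable.
    exact: Cb_mul_continuous.
  by move=> k Sk; exact/S/exp_sumsM.
Qed.

Lemma ap_subring : subring_closed ap_pred.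
Proof.
have [P1 PZ PD PM] := ap_subsemi; split=> // f g Pf Pg.
by rewrite -scaleN1r PD ?PZ.
Qed.

Lemma ap_submod : submod_closed ap_pred.
Proof.
have [P1 PZ PD PM] := ap_subsemi; split=> [|a f g Pf Pg].
  by rewrite -(scale0r 1) PZ.
by rewrite PD ?PZ.
Qed.

HB.instance Definition _ :=
  GRing.SubChoice_isSubComNzRing.Build (Cb R X) ap_pred AP ap_subring.
HB.instance Definition _ :=
  GRing.SubZmodule_isSubLmodule.Build R[i] (Cb R X) ap_pred AP ap_submod.

Lemma AP_scaleAl (a : C) (f g : AP) : a *: (f * g) = a *: f * g.
Proof. by apply: val_inj; rewrite /= scalerAl. Qed.

HB.instance Definition _ := GRing.Lmodule_isLalgebra.Build R[i] AP AP_scaleAl.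
HB.instance Definition _ := GRing.Lalgebra_isComAlgebra.Build R[i] AP.

Definition AP_norm (f : AP) : C := `|AP_val f|.

Lemma AP_normD f g : AP_norm (f + g) <= AP_norm f + AP_norm g.
Proof. exact: ler_normD. Qed.

Lemma AP_normZ (a : C) f : AP_norm (a *: f) = `|a| * AP_norm f.
Proof. exact: normrZ. Qed.

Lemma AP_norm_eq0 f : AP_norm f = 0 -> f = 0.
Proof. by move=> /normr0_eq0 f0; exact: val_inj. Qed.

HB.instance Definition _ :=
  Lmodule_isNormed.Build R[i] AP AP_normD AP_normZ AP_norm_eq0.

End ExpSums.

Section APplus.
Variable R : realType.
Local Open Scope complex_scope.

Definition Cplus : Type := set_type [set z : R[i] | 0 < complex.Im z].

Lemma Cplus_i : 'i%C \in [set z : R[i] | 0 < complex.Im z].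
Proof. by rewrite inE /= ltr01. Qed.

HB.instance Definition _ := Topological.on Cplus.
HB.instance Definition _ := isPointed.Build Cplus (exist _ 'i%C Cplus_i).

Definition APplus : Type := @AP R R (fun t => t%:C).
Definition APplus_hol : Type := @AP R Cplus (fun z => set_val z).

HB.instance Definition _ := GRing.ComAlgebra.on APplus.
HB.instance Definition _ := NormedModule.on APplus.
HB.instance Definition _ := GRing.ComAlgebra.on APplus_hol.
HB.instance Definition _ := NormedModule.on APplus_hol.

End APplus.

(* Main.v *)
(* Let al_i, be_i (i < 2n) be Z-independent positive frequencies and let S_i be
   (e^(i al_i t) - e^(i be_i t)) / 2i.  By Kronecker's theorem the functions S_i
   take, up to small errors, all values sin theta_i simultaneously, with theta in
   R^(2n), while any further element of the algebra is approximated by a function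
   that is continuous in theta.  Hence f_j = S_j + i S_(n+j) restricts on the cube
   [-pi/2, pi/2]^(2n) to an essential map into C^n: by the Poincare-Miranda
   theorem it cannot be uniformly approximated by zero-free maps, so that f is not
   a limit of invertible tuples.  With g = 1 - sum_i S_i^2 the tuple (f, g) is
   invertible, and an invertible f + a g would yield a zero-free map on the cube
   after replacing 1 - sum_i sin^2 theta_i by its positive part, which does not
   change f on the faces of the cube; again a contradiction. *)
Require Import Defs.
From mathcomp Require Import all_boot all_order all_algebra.
From mathcomp Require Import ring lra reals.

Set Implicit Arguments.
Unset Strict Implicit.
Unset Printing Implicit Defensive.

Import Order.TTheory GRing.Theory Num.Theory.

Local Open Scope ring_scope.

(** * A discrete Poincare-Miranda theorem *)

Section CubicalCup.
Variables (m k : nat).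
Local Notation vertex := {ffun 'I_m -> 'I_k.+1}.
Variable c : 'I_m -> vertex -> 'F_2.

Definition put (v : vertex) (j : 'I_m) (a : 'I_k.+1) : vertex :=
  [ffun i => if i == j then a else v i].

(** Past the top layer [inord] falls back to 0, so [step] is cyclic in the coordinate [j]; [box]
    keeps the directions of a cube away from this wrap-around. *)
Definition step (v : vertex) (j : 'I_m) : vertex := put v j (inord (v j).+1).

(* The mod 2 cup product of the coboundaries of the c i, for i in s, evaluated
   on the cube with lowest vertex v and directions J. *)
Fixpoint cup (s : seq 'I_m) (v : vertex) (J : {set 'I_m}) : 'F_2 :=
  if s is i :: s' then
    \sum_(j in J) (c i v + c i (step v j)) * cup s' (step v j) (J :\ j)
  else 1.

Lemma addF2 (x : 'F_2) : x + x = 0.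
Proof. by rewrite -mulr2n -mulr_natr (_ : 2%:R = 0) ?mulr0 //; apply/val_inj. Qed.

(** The terms at [(i, j)] and [(j, i)] are equal, so they cancel in pairs modulo 2. *)
Lemma sum_offdiag_sym (J : {set 'I_m}) (h : 'I_m -> 'I_m -> 'F_2) :
  (forall i j, h i j = h j i) -> \sum_(j in J) \sum_(i in J :\ j) h i j = 0.
Proof.
move=> hC.
have E j : \sum_(i in J :\ j) h i j = \sum_(i in J | (i != j)) h i j.
  by apply: eq_bigl => i; rewrite !inE andbC.
under eq_bigr do rewrite E.
have D j : \sum_(i in J | i != j) h i j =
  \sum_(i in J | (i < j)%N) h i j + \sum_(i in J | (j < i)%N) h i j.
  rewrite (bigID (fun i : 'I_m => (i < j)%N)) /=; congr (_ + _); apply: eq_bigl => i.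
    by rewrite -andbA neq_ltn; case: ltngtP.
  by rewrite -andbA -val_eqE /=; case: ltngtP.
under eq_bigr do rewrite D.
rewrite big_split /= [X in _ + X](exchange_big_dep (mem J)) /=; last by move=> i j _ /andP[].
rewrite -big_split /=; apply: big1 => j jJ.
under [X in _ + X]eq_bigl do rewrite jJ /=.
under [X in _ + X]eq_bigr do rewrite hC.
by rewrite addF2.
Qed.

Lemma stepC v i j : step (step v i) j = step (step v j) i.
Proof.
have [->//|ij] := eqVneq i j; apply/ffunP => l; rewrite !ffunE.
rewrite (negPf ij) [j == i]eq_sym (negPf ij).
by have [->|_] := eqVneq l j; rewrite // eq_sym (negPf ij).
Qed.

Lemma setD1C (J : {set 'I_m}) i j : J :\ i :\ j = J :\ j :\ i.
Proof. by rewrite !setDDl setUC. Qed.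

Lemma sum_offdiag_swap (J : {set 'I_m}) (h : 'I_m -> 'I_m -> 'F_2) :
  \sum_(j in J) \sum_(i in J :\ j) h i j = \sum_(j in J) \sum_(i in J :\ j) h j i.
Proof.
rewrite [LHS](exchange_big_dep (mem J)) /=; last by move=> i j _; rewrite !inE => /andP[].
apply: eq_bigr => j jJ; apply: eq_bigl => i.
by rewrite !inE jJ eq_sym andbT andbC.
Qed.

(** A cup product of coboundaries is a cocycle. In the expansion of both sides, the terms with [c i]
    taken two steps away are symmetric in the two directions and cancel modulo 2; so do those with
    [c i v], once the induction hypothesis is applied. The same hypothesis matches the rest. *)
Lemma cup_closed s v (J : {set 'I_m}) :
  \sum_(j in J) cup s (step v j) (J :\ j) = \sum_(j in J) cup s v (J :\ j).
Proof.
elim: s v J => [|i s IH] v J //=.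
rewrite (eq_bigr (fun j => \sum_(l in J :\ j)
  (c i (step v j) * cup s (step (step v j) l) (J :\ j :\ l) +
   c i (step (step v j) l) * cup s (step (step v j) l) (J :\ j :\ l)))); last first.
  by move=> j _; apply: eq_bigr => l _; rewrite mulrDl.
rewrite [RHS](eq_bigr (fun j =>
  c i v * (\sum_(l in J :\ j) cup s (step v l) (J :\ j :\ l)) +
  \sum_(l in J :\ j) c i (step v l) * cup s (step v l) (J :\ j :\ l))); last first.
  by move=> j _; rewrite mulr_sumr -big_split; apply: eq_bigr => l _; rewrite mulrDl.
under eq_bigr do rewrite big_split.
rewrite !big_split /= [X in _ + X](sum_offdiag_sym J
  (h := fun l j =>
    c i (step (step v j) l) * cup s (step (step v j) l) (J :\ j :\ l))); last first.
  by move=> l j; rewrite stepC setD1C.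
rewrite addr0 -mulr_sumr.
under [X in _ = c i v * X + _]eq_bigr do rewrite IH.
rewrite (sum_offdiag_sym J (h := fun l j => cup s v (J :\ j :\ l))); last first.
  by move=> l j; rewrite setD1C.
rewrite mulr0 add0r [RHS](sum_offdiag_swap J
  (fun l j => c i (step v l) * cup s (step v l) (J :\ j :\ l))).
apply: eq_bigr => j jJ; rewrite -!mulr_sumr IH; congr (_ * _).
by apply: eq_bigr => l _; rewrite setD1C.
Qed.

Hypothesis c0 : forall i (v : vertex), v i = ord0 -> c i v = 0.
Hypothesis c1 : forall i (v : vertex), v i = ord_max -> c i v = 1.

(** Lowest vertices of the unit cubes that tile the face on which all coordinates outside [J] equal
    [k]. *)
Definition box (J : {set 'I_m}) : pred vertex :=
  fun v => [forall i, if i \in J then v i < k else v i == k :> nat]%N.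

(** On a cube lying in a face where the coordinate [j] is 0 or [k], the function [c j] is constant,
    so its coboundary, one of the factors, vanishes. *)
Lemma cup_face s (v : vertex) (J : {set 'I_m}) j : j \in s -> j \notin J ->
  v j = ord0 \/ v j = ord_max -> cup s v J = 0.
Proof.
elim: s v J => // i s IH v J; rewrite inE => js jJ vj /=.
apply: big1 => l lJ.
have lj : j != l by apply: contraNneq jJ => ->.
have svj : step v l j = v j by rewrite ffunE (negPf lj).
have [ij|ij] := eqVneq j i.
  rewrite -ij; case: vj => vj; first by rewrite !c0 ?svj // addr0 mul0r.
  by rewrite !c1 ?svj // addF2 mul0r.
rewrite IH ?mulr0 ?svj //; first by move: js; rewrite (negPf ij).
by rewrite !inE negb_and jJ orbT.
Qed.

(** Modulo 2 the intermediate layers in direction [j] occur twice and cancel; only those at [k] and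
    at 0 survive. *)
Lemma box_telescope (J : {set 'I_m}) j (h : vertex -> 'F_2) : j \in J ->
  \sum_(v | box J v) (h v + h (step v j)) =
  \sum_(v | box (J :\ j) v) h v + \sum_(v | box (J :\ j) v) h (put v j ord0).
Proof.
(* [B] frees the coordinate [j]. The lower ends of the edges in direction [j] fill [B] without its
   top layer, the upper ends fill [B] without its bottom layer. *)
move=> jJ; pose B (v : vertex) :=
  [forall i, if i == j then true else if i \in J then v i < k else v i == k :> nat]%N.
have B1 : box J =1 (fun v => B v && (v j != ord_max)).
  move=> v; apply/forallP/andP => [H|[/forallP H vj] i].
    split; first by apply/forallP => i; case: eqP => // _; exact: H.
    by move: (H j); rewrite jJ -val_eqE /= ltn_neqAle => /andP[].
  have := H i; case: eqP => // -> _; rewrite jJ ltn_neqAle -ltnS ltn_ord andbT.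
  by move: vj; rewrite -val_eqE.
have B2 : box (J :\ j) =1 (fun v => B v && (v j == ord_max)).
  move=> v; apply/forallP/andP => [H|[/forallP H vj] i].
    split; first by apply/forallP => i; move: (H i); rewrite !inE; case: eqP.
    by move: (H j); rewrite !inE eqxx -val_eqE.
  by have := H i; rewrite !inE; have [->|] := eqVneq i j => //= _; rewrite (eqP vj).
have S1 : \sum_(v | box J v) h v = \sum_(v | B v) h v + \sum_(v | box (J :\ j) v) h v.
  rewrite (eq_bigl _ _ B1) (eq_bigl _ _ B2) (bigID (fun v : vertex => v j == ord_max) B) /=.
  by rewrite addrAC addF2 add0r.
have S2 : \sum_(v | box J v) h (step v j) =
   \sum_(v | B v && (v j != ord0)) h v.
  rewrite [RHS](reindex_onto (fun v => step v j)
     (fun v : vertex => put v j (inord (v j).-1))) /=.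
    apply: eq_bigl => v; rewrite B1; apply/andP/andP.
      move=> [Bv vj].
      have vk : (v j < k)%N.
        by rewrite ltn_neqAle -ltnS ltn_ord andbT; move: vj; rewrite -val_eqE.
      split; first (apply/andP; split).
      + apply/forallP => i; have /forallP/(_ i) := Bv; rewrite ffunE; by case: eqP.
      + by rewrite ffunE eqxx -val_eqE /= inordK.
      + apply/eqP/ffunP => i; rewrite !ffunE eqxx; case: eqP => // ->.
        by rewrite [in X in X.-1]inordK /= ?inord_val.
    move=> [/andP[Bv vj] _]; split.
      apply/forallP => i; have /forallP/(_ i) := Bv; rewrite ffunE; by case: eqP.
    apply: contraNneq vj => vj; rewrite ffunE eqxx vj.
    by rewrite -val_eqE /= val_insubd ltnn.
  move=> v /andP[Bv vj]; apply/ffunP => i; rewrite !ffunE eqxx; case: eqP => // ->.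
  have v0 : (0 < v j)%N by rewrite lt0n; move: vj; rewrite -val_eqE.
  by rewrite (@inordK _ (v j).-1) ?prednK ?inord_val // ltnW.
have S3 : \sum_(v | B v && (v j == ord0)) h v =
   \sum_(v | box (J :\ j) v) h (put v j ord0).
  rewrite (reindex_onto (fun v : vertex => put v j ord0)
     (fun v : vertex => put v j ord_max)) /=.
    apply: eq_bigl => v; rewrite B2; apply/andP/andP.
      move=> [/andP[Bv _] /eqP E]; split.
        apply/forallP => i; have /forallP/(_ i) := Bv; rewrite ffunE; by case: eqP.
      by rewrite -E !ffunE eqxx.
    move=> [Bv /eqP vj]; split; first (apply/andP; split).
    + apply/forallP => i; have /forallP/(_ i) := Bv; rewrite ffunE; by case: eqP.
    + by rewrite ffunE eqxx.
    + by apply/eqP/ffunP => i; rewrite !ffunE; case: eqP => // ->.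
  by move=> v /andP[_ /eqP vj]; apply/ffunP => i; rewrite !ffunE; case: eqP => // ->.
rewrite big_split /= S1 S2 -S3 (bigID (fun v : vertex => v j == ord0) B) /=.
by rewrite addrAC -[X in X + _]addrA addF2 addr0 addrC.
Qed.

(* Stokes: by closedness the sum telescopes to the faces of the box; it vanishes
   on all of them except the one where v i = k, i the head of s, since c i = 1. *)
Lemma sum_cup s (J : {set 'I_m}) : uniq s -> s =i J -> \sum_(v | box J v) cup s v J = 1.
Proof.
elim: s J => [|i s IH] J /=.
  move=> _ sJ; have {sJ}-> : J = set0 by apply/setP => i; rewrite -sJ inE.
  rewrite (big_pred1 [ffun => ord_max]) // => v.
  apply/forallP/eqP => [H|-> i]; last by rewrite inE ffunE.
  by apply/ffunP => i; apply/val_inj; rewrite ffunE /=; move: (H i); rewrite inE => /eqP.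
move=> /andP[is_ us] sJ.
have iJ : i \in J by rewrite -sJ mem_head.
rewrite (eq_bigr (fun v => \sum_(j in J)
  (c i v * cup s v (J :\ j) + c i (step v j) * cup s (step v j) (J :\ j)))); last first.
  move=> v _; rewrite big_split /= -mulr_sumr -cup_closed mulr_sumr -big_split.
  by apply: eq_bigr => j _; rewrite mulrDl.
rewrite exchange_big /= (bigD1 i) //= [X in _ + X]big1 ?addr0; last first.
  move=> j /andP[jJ ji]; rewrite (box_telescope (fun v => c i v * cup s v (J :\ j))) //.
  have js : j \in s by move: jJ; rewrite -sJ inE (negPf ji).
  rewrite !big1 ?addr0 // => v /forallP vB; rewrite (@cup_face s _ _ j) ?mulr0 ?inE ?eqxx //.
    by left; rewrite ffunE eqxx.
  by right; apply/val_inj/eqP; have := vB j; rewrite !inE eqxx.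
rewrite (box_telescope (fun v => c i v * cup s v (J :\ i))) //.
rewrite [X in _ + X]big1 ?addr0; last by move=> v _; rewrite c0 ?mul0r // ffunE eqxx.
rewrite -[RHS](IH (J :\ i)) //.
  apply: eq_bigr => v /forallP vB; rewrite c1 ?mul1r //.
  by apply/val_inj/eqP; have := vB i; rewrite !inE eqxx.
move=> j; rewrite !inE -sJ inE; case: eqVneq => //= ->; exact: negPf.
Qed.

Definition cube (v : vertex) (J : {set 'I_m}) (p : vertex) : Prop :=
  forall l, p l = v l \/ (l \in J) /\ p l = inord (v l).+1.

(** Some term of the expanded sum is nonzero, and its factors are differences of the [c i] along
    edges of the cube. *)
Lemma cup_neq0 s v (J : {set 'I_m}) : cup s v J != 0 ->
  forall i, i \in s -> exists p q, [/\ cube v J p, cube v J q & c i p != c i q].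
Proof.
elim: s v J => // i s IH v J /= nz l.
have /exists_inP[j jJ] : [exists (j | j \in J),
    (c i v + c i (step v j)) * cup s (step v j) (J :\ j) != 0].
  apply: contraNT nz; rewrite negb_exists_in => /forall_inP H.
  by apply/eqP/big1 => j jJ; apply/eqP; have := H _ jJ; rewrite negbK.
rewrite mulf_eq0 negb_or => /andP[ci cj]; rewrite inE => /orP[/eqP->|ls].
  exists v, (step v j); split.
  - by move=> a; left.
  - by move=> a; rewrite ffunE; case: eqP => [->|_]; [right|left].
  - by apply: contraNneq ci => ->; rewrite addF2.
have [p [q [pc qc pq]]] := IH _ _ cj _ ls.
exists p, q; split=> // a.
  case: (pc a) => [->|[]]; first by rewrite ffunE; case: eqP => [->|_]; [right|left].
  by rewrite !inE ffunE => /andP[/negPf-> aJ] ->; right.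
case: (qc a) => [->|[]]; first by rewrite ffunE; case: eqP => [->|_]; [right|left].
by rewrite !inE ffunE => /andP[/negPf-> aJ] ->; right.
Qed.

(** A cubical form of Sperner's lemma: the cup products over all unit cubes add up to 1, so one of
    them is nonzero. *)
Lemma sign_change_cube : exists v : vertex, (forall l, (v l < k)%N) /\
  forall i, exists p q, [/\ cube v setT p, cube v setT q & c i p != c i q].
Proof.
have S := @sum_cup (enum 'I_m) setT (enum_uniq _).
have /exists_inP[v vB nz] : [exists (v | box setT v), cup (enum 'I_m) v setT != 0].
  rewrite -[X in is_true X]negbK negb_exists_in; apply/negP => /forall_inP H.
  have : \sum_(v | box setT v) cup (enum 'I_m) v setT = 0.
    by apply: big1 => v vB; apply/eqP; have := H _ vB; rewrite negbK.
  by rewrite S => [/eqP|i]; rewrite ?oner_eq0 // mem_enum !inE.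
exists v; split; first by move=> l; have /forallP/(_ l) := vB; rewrite inE.
by move=> i; apply: (cup_neq0 nz); rewrite mem_enum.
Qed.

End CubicalCup.

(** The signs of the [F i] label a fine grid, and on some grid cube all labels change. The zero is
    only approximate, so uniform continuity suffices. Strictness on the face [x i = a] alone fits
    labels that record [0 <= F i]. *)
Lemma poincare_miranda (R : realType) (m : nat) (a b : R)
    (F : 'I_m -> ('I_m -> R) -> R) (cb := fun x : 'I_m -> R => forall l, a <= x l <= b) :
  a < b ->
  (forall e : R, 0 < e -> exists2 d : R, 0 < d & forall x y, cb x -> cb y ->
     (forall l, `|x l - y l| <= d) -> forall i, `|F i x - F i y| < e) ->
  (forall x i, cb x -> x i = a -> F i x < 0) ->
  (forall x i, cb x -> x i = b -> 0 <= F i x) ->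
  forall e : R, 0 < e -> exists2 x, cb x & forall i, `|F i x| < e.
Proof.
move=> ab ucF Fa Fb e e0.
(* One half of [e] bounds [F i] at a vertex of a cube with a sign change; the other half carries the
   bound to its lowest vertex. *)
have [d d0 Fd] := ucF (e / 2) (divr_gt0 e0 (ltr0Sn _ _)).
have [k k0 kd] : exists2 k : nat, 0 < k%:R :> R & (b - a) / k%:R <= d.
  exists (Num.truncn ((b - a) / d)).+1; first by rewrite ltr0Sn.
  by rewrite ler_pdivrMr ?ltr0Sn // mulrC -ler_pdivrMr //; apply/ltW/truncnS_gt.
pose pt (v : {ffun 'I_m -> 'I_k.+1}) (l : 'I_m) := a + (b - a) * (v l)%:R / k%:R.
have pt_cb v : cb (pt v).
  move=> l; rewrite /pt lerDl divr_ge0 ?mulr_ge0 ?subr_ge0 ?(ltW ab) //=.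
  rewrite -lerBrDl ler_pdivrMr // ler_wpM2l ?subr_ge0 ?(ltW ab) //.
  by rewrite ler_nat -ltnS.
pose c i v : 'F_2 := ((0 <= F i (pt v))%R : nat)%:R.
have [|i v vi|v [vk vc]] := @sign_change_cube m k c.
- by move=> i v vi; rewrite /c leNgt Fa // /pt vi mulr0 mul0r addr0.
- by rewrite /c Fb // /pt vi mulfK ?gt_eqF // addrC subrK.
have near p q : cube v setT p -> cube v setT q -> forall l, `|pt p l - pt q l| <= d.
  move=> pv qv l; apply: le_trans kd.
  have E w : cube v setT w -> (w l)%:R = (v l)%:R :> R \/ (w l)%:R = (v l)%:R + 1 :> R.
    case/(_ l) => [->|[_ ->]]; [by left|right].
    by rewrite inordK -?natr1 // ltnS.
  have D : pt p l - pt q l = (b - a) / k%:R * ((p l)%:R - (q l)%:R) by rewrite /pt; ring.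
  have b0 : 0 <= (b - a) / k%:R by rewrite divr_ge0 ?subr_ge0 ?ltW.
  rewrite D normrM ger0_norm // ler_piMr //.
  by case: (E p pv) => ->; case: (E q qv) => ->; rewrite ler_norml; lra.
have vv : cube v setT v by move=> l; left.
exists (pt v) => // i; have [p [q [pv qv]]] := vc i; rewrite /c => pq.
have A := Fd _ _ (pt_cb p) (pt_cb q) (near _ _ pv qv) i.
have B := Fd _ _ (pt_cb v) (pt_cb p) (near _ _ vv pv) i.
move: A B pq; rewrite !ltr_norml.
by have [|] := leP 0 (F i (pt p)); have [|] := leP 0 (F i (pt q)); rewrite ?eqxx //; lra.
Qed.

From mathcomp Require Import all_classical all_reals all_analysis.
From mathcomp Require Import zify complex.

Import numFieldNormedType.Exports.

Local Open Scope classical_set_scope.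
Local Open Scope ring_scope.
Local Open Scope complex_scope.

(** * Kronecker's theorem *)

Section UnitCircle.
Variable R : realType.
Local Notation C := R[i].

Definition expi (x : R) : C := cexp ('i * x%:C).

Lemma expiE x : expi x = cos x +i* sin x.
Proof.
rewrite /expi /cexp (_ : 'i * x%:C = 0 +i* x); last by simpc.
by rewrite expR0 mul1r.
Qed.

Lemma expi0 : expi 0 = 1. Proof. by rewrite /expi mulr0 cexp0. Qed.

Lemma expiD x y : expi (x + y) = expi x * expi y.
Proof. by rewrite /expi rmorphD mulrDr cexpD. Qed.

Lemma norm_expi x : `|expi x| = 1.
Proof. by rewrite expiE normc_def /= cos2Dsin2 sqrtr1. Qed.

Lemma expi_sum (I : Type) (r : seq I) (P : pred I) (F : I -> R) :
  expi (\sum_(i <- r | P i) F i) = \prod_(i <- r | P i) expi (F i).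
Proof. exact: (big_morph expi expiD expi0). Qed.

Lemma expi_pi : expi pi = -1.
Proof. by rewrite expiE cospi sinpi -[-1 in RHS]/(- 1%:C) -rmorphN. Qed.

Lemma lipschitz_cos (x y : R) : `|cos x - cos y| <= `|x - y|.
Proof.
wlog yx : x y / y < x.
  by move=> H; have [/H|/H//|->] := ltgtP x y; rewrite ?subrr // distrC [leRHS]distrC.
have [c _ ->] := @MVT R cos (fun z => - sin z) y x yx (fun z _ => is_derive_cos z)
  (continuous_subspaceT (@continuous_cos R)).
by rewrite normrM normrN ler_piMl // sin_max.
Qed.

Lemma lipschitz_sin (x y : R) : `|sin x - sin y| <= `|x - y|.
Proof.
rewrite -!cosBpihalf; apply: le_trans (lipschitz_cos _ _) _.
by rewrite opprD addrACA subrr addr0.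
Qed.

Lemma norm_le_ReIm (z : C) : `|z| <= (`|complex.Re z| + `|complex.Im z|)%:C.
Proof.
rewrite [z in `|z|]complexE; apply: le_trans (ler_normD _ _) _.
rewrite normrM [`|'i%C|](_ : _ = 1) ?mul1r ?rmorphD; last first.
  by rewrite normc_def /= expr0n /= add0r expr1n sqrtr1.
by rewrite !normc_def /= expr0n /= !addr0 !sqrtr_sqr.
Qed.

Lemma lipschitz_expi (x y : R) : `|expi x - expi y| <= (2 * `|x - y|)%:C.
Proof.
apply: le_trans (norm_le_ReIm _) _; rewrite lecR !expiE /=.
by rewrite mulr_natl mulr2n lerD ?lipschitz_cos ?lipschitz_sin.
Qed.

(* Averaging q(t) and q(t + pi / nu k) removes the frequency nu k and keeps the
   constant term. *)
Lemma norm_mean_le (I : finType) (c : I -> C) (nu : I -> R) (B : C) :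
  (forall t, `|\sum_i c i * expi (nu i * t)| <= B) ->
  `|\sum_(i | nu i == 0) c i| <= B.
Proof.
have [n] := ubnP #|[pred i | (nu i != 0) && (c i != 0)]|.
elim: n c => // n IH c; rewrite ltnS => cn cB.
have [k /andP[nuk ck]|c0] := pickP [pred i | (nu i != 0) && (c i != 0)]; last first.
  suff -> : \sum_(i | nu i == 0) c i = \sum_i c i * expi (nu i * 0) by [].
  rewrite [RHS](bigID (fun i => nu i == 0)) /= [X in _ + X]big1 ?addr0.
    by apply: eq_bigr => i _; rewrite mulr0 expi0 mulr1.
  move=> i nui; have := c0 i; rewrite /= nui => /negbFE/eqP ->.
  by rewrite mul0r.
pose c' i := c i * ((1 + expi (nu i * (pi / nu k))) / 2).
have -> : \sum_(i | nu i == 0) c i = \sum_(i | nu i == 0) c' i.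
  by apply: eq_bigr => i /eqP nui; rewrite /c' nui mul0r expi0 divff ?mulr1.
apply: IH.
  apply: leq_trans cn; apply/proper_card/properP; split.
    apply/fintype.subsetP => i; rewrite !inE /c' => /andP[-> /=].
    by rewrite mulf_eq0 negb_or => /andP[].
  exists k; rewrite !inE ?nuk ?ck //= /c' negbK.
  by rewrite [nu k * _]mulrCA divff // mulr1 expi_pi subrr mul0r mulr0.
move=> t; have -> : \sum_i c' i * expi (nu i * t) =
    (\sum_i c i * expi (nu i * t) + \sum_i c i * expi (nu i * (t + pi / nu k))) / 2.
  rewrite -big_split mulr_suml; apply: eq_bigr => i _ /=.
  rewrite mulrDr expiD /c'; ring.
rewrite normrM [`|2^-1|]ger0_norm ?invr_ge0 ?ler0n // ler_pdivrMr ?ltr0n //.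
apply: le_trans (ler_normD _ _) _.
by rewrite mulr_natr mulr2n lerD.
Qed.

End UnitCircle.

Section Kronecker.
Variable R : realType.
Local Notation C := R[i].
Implicit Types (s : seq R) (phi : R -> R).

(* Says that phi induces a homomorphism from the group generated by s to R. *)
Definition rel_preserving s phi := forall c : R -> int,
  \sum_(x <- s) x *~ c x = 0 -> \sum_(x <- s) phi x *~ c x = 0.

(** [R] is divisible, so homomorphisms into it extend. A relation that involves [x] dictates the
    value at [x], after division by its coefficient; without such a relation the value 0 is
    taken. *)
Lemma rel_preserving_cons s phi x : x \notin s -> rel_preserving s phi ->
  exists2 phi', {in s, phi' =1 phi} & rel_preserving (x :: s) phi'.
Proof.
move=> xs phiP.
have big_upd (y : R) c : \sum_(z <- s) [eta phi with x |-> y] z *~ c z =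
    \sum_(z <- s) phi z *~ c z.
  by apply: eq_big_seq => z zs /=; case: eqP => // zx; rewrite -zx zs in xs.
have eq_upd (y : R) : {in s, [eta phi with x |-> y] =1 phi}.
  by move=> z zs /=; case: eqP => // zx; rewrite -zx zs in xs.
have [[c [cx crel]]|free] := pselect (exists c : R -> int,
    c x != 0 /\ \sum_(z <- x :: s) z *~ c z = 0); last first.
  exists [eta phi with x |-> 0]; first exact: eq_upd.
  move=> c crel; have cx : c x = 0.
    by apply/eqP; apply: contrapT => /negP cx; apply: free; exists c.
  move: crel; rewrite !big_cons cx !mulr0z !add0r big_upd; exact: phiP.
pose y := - (\sum_(z <- s) phi z *~ c z) / (c x)%:~R.
exists [eta phi with x |-> y]; first exact: eq_upd.
move=> c' c'rel; move: crel c'rel; rewrite !big_cons /= eqxx big_upd.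
move=> /eqP; rewrite addr_eq0 => /eqP crel /eqP; rewrite addr_eq0 => /eqP c'rel.
have c0 : (c x)%:~R != 0 :> R by rewrite intr_eq0.
(* This combination of the two relations eliminates [x] and leaves a relation on [s], to which
   [phiP] applies. *)
have lin (f : R -> R) : \sum_(z <- s) f z *~ (c x * c' z - c' x * c z) =
    (c x)%:~R * \sum_(z <- s) f z *~ c' z - (c' x)%:~R * \sum_(z <- s) f z *~ c z.
  rewrite !mulr_sumr -sumrB; apply: eq_bigr => z _.
  by rewrite -[LHS]mulrzr -(mulrzr (f z) (c z)) -(mulrzr (f z) (c' z)) intrB !intrM; ring.
have : \sum_(z <- s) phi z *~ (c x * c' z - c' x * c z) = 0.
  apply: phiP; rewrite lin -[X in _ * X - _]opprK -c'rel -[X in _ - _ * X]opprK -crel.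
  by rewrite -(mulrzr x (c x)) -(mulrzr x (c' x)); ring.
rewrite lin => /eqP; rewrite subr_eq0 => /eqP E.
apply: (mulfI c0); rewrite mulr0 mulrDr E -mulrzr /y.
by field.
Qed.

Lemma rel_preserving_extend s phi (L : seq R) : uniq s -> rel_preserving s phi ->
  exists (s' : seq R) (phi' : R -> R), [/\ uniq s', {subset s <= s'}, {subset L <= s'},
    {in s, phi' =1 phi} & rel_preserving s' phi'].
Proof.
move=> us sP; elim: L => [|x L [s' [phi' [us' ss' Ls' E sP']]]].
  by exists s, phi; split.
have [xs'|xs'] := boolP (x \in s').
  by exists s', phi'; split=> // y; rewrite inE => /predU1P[->//|/Ls'].
have [phi'' E' sP''] := rel_preserving_cons xs' sP'.
exists (x :: s'), phi''; split=> //=; first by rewrite xs'.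
- by move=> y ys; rewrite inE ss' // orbT.
- by move=> y; rewrite !inE => /orP[->//|/Ls' ->]; rewrite orbT.
- by move=> y ys; rewrite E' ?ss' // E.
Qed.

Lemma poly_lt_exp (x : R) (d : nat) : 0 < x -> exists p : nat,
  p.+1%:R ^+ d < (1 + x) ^+ p.
Proof.
move=> x0; pose q := (Num.truncn (d.+2%:R ^+ d / x ^+ d.+1)).+1.
have q0 : 0 < q%:R :> R by rewrite ltr0Sn.
have qx : d.+2%:R ^+ d < q%:R * x ^+ d.+1.
  by rewrite -ltr_pdivrMr ?exprn_gt0 // truncnS_gt.
(* With p = q(d+1) one has (p+1)^d <= (q(d+2))^d < (qx)^(d+1) <= (1+x)^p, in the middle by the
   choice of [q] and at the end by a weak Bernoulli inequality. *)
exists (q * d.+1)%N.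
have Bern : q%:R * x <= (1 + x) ^+ q.
  elim: q {q0 qx} => [|q IH]; first by rewrite mul0r.
  rewrite exprS mulrDl mul1r -natr1 mulrDl mul1r lerD //.
  by rewrite ler_peMr ?(ltW x0) // exprn_ege1 // lerDl ltW.
rewrite exprM; apply: (@lt_le_trans _ _ ((q%:R * x) ^+ d.+1)); last first.
  by apply: lerXn2r => //; rewrite nnegrE ?exprn_ge0 ?addr_ge0 ?mulr_ge0 ?ltW.
apply: (@le_lt_trans _ _ ((q%:R * d.+2%:R) ^+ d)).
  apply: lerXn2r; rewrite ?nnegrE ?ler0n ?mulr_ge0 //.
  by rewrite -natrM ler_nat; lia.
rewrite !exprMn [q%:R ^+ d.+1]exprSr -mulrA ltr_pM2l ?exprn_gt0 //.
Qed.

(** The squared moduli of [expi x - 1] and [1 + expi x] add up to 4, and 4 - e^2 <= (2 -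
    e^2/8)^2. *)
Lemma norm1Dexpi_le (x e : R) : 0 <= e -> e%:C <= `|expi x - 1| ->
  `|1 + expi x| <= (2 - e ^+ 2 / 8)%:C.
Proof.
move=> e0 ex.
have N1 : `|expi x - 1| ^+ 2 = (2 - 2 * cos x)%:C.
  rewrite -add_Re2_Im2 expiE /=; congr _%:C.
  by have := cos2Dsin2 x; lra.
have N2 : `|1 + expi x| ^+ 2 = (2 + 2 * cos x)%:C.
  rewrite -add_Re2_Im2 expiE /=; congr _%:C.
  by have := cos2Dsin2 x; lra.
have A : e ^+ 2 <= 2 - 2 * cos x.
  rewrite -lecR -N1 rmorphXn; apply: lerXn2r ex; rewrite nnegrE; last exact: normr_ge0.
  by rewrite ler0c.
have c1 := cos_geN1 x.
have E4 : e ^+ 2 <= 4 by lra.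
have p0 : 0 <= 2 - e ^+ 2 / 8 by lra.
have : `|1 + expi x| ^+ 2 <= (2 - e ^+ 2 / 8)%:C ^+ 2.
  by rewrite N2 -rmorphXn lecR; have := sqr_ge0 e; have := sqr_ge0 (e ^+ 2 / 8); lra.
by rewrite ler_pXn2r // nnegrE ler0c.
Qed.

(* Bohr's proof: if all phases of P t = sum_(x <- s) expi (t x - phi x) could not
   be simultaneously close to 1, then |P| would stay below B < size s. The p-th
   power of P has size s ^+ p terms; grouped by frequency, each group has the size
   of a Fourier coefficient of P ^+ p, at most B ^+ p, and there are only
   polynomially many groups. *)
Lemma kronecker s phi (e : R) : uniq s -> 0 \in s -> rel_preserving s phi -> 0 < e ->
  exists t, forall x, x \in s -> `|expi (x * t) - expi (phi x)| < e%:C.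
Proof.
move=> us s0 sP e0; apply: contrapT => noT.
have far t : exists2 x, x \in s & e%:C <= `|expi (x * t - phi x) - 1|.
  apply: contrapT => nx; apply: noT; exists t => x xs.
  have -> : expi (x * t) - expi (phi x) = expi (phi x) * (expi (x * t - phi x) - 1).
    by rewrite mulrBr mulr1 -expiD [phi x + _]addrC subrK.
  rewrite normrM norm_expi mul1r real_ltNge ?normr_real //; last first.
    by apply/complex_realP; exists e.
  by apply/negP => ex; apply: nx; exists x.
have phi0 : phi 0 = 0.
  have E (f : R -> R) : \sum_(x <- s) f x *~ (x == 0)%:Z = f 0.
    rewrite (bigD1_seq 0) //= eqxx mulr1z big1 ?addr0 // => x /negPf ->.
    by rewrite mulr0z.
  by have := sP (fun x => (x == 0)%:Z); rewrite (E id) (E phi); apply.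
pose M := size s; pose k := e ^+ 2 / 8.
have k0 : 0 < k by rewrite divr_gt0 ?exprn_gt0 // ltr0n.
pose P t := \sum_(x <- s) expi (x * t - phi x).
(* The frequency 0 contributes the constant term 1 to [P]. Adding to it a term at distance at least
   [e] from 1 loses [k] against the trivial bound [M]. *)
have PB t : `|P t| <= (M%:R - k)%:C.
  have [x xs ex] := far t.
  have x0 : x != 0.
    apply: contraTneq ex => ->; rewrite mul0r phi0 subr0 expi0 subrr normr0.
    by rewrite lecR -ltNge.
  have split2 (f : R -> C) : \sum_(z <- s) f z =
      f 0 + f x + \sum_(z <- s | (z != 0) && (z != x)) f z.
    rewrite (bigD1_seq 0) //= -addrA; congr (_ + _).
    rewrite -big_filter (bigD1_seq x) ?filter_uniq ?mem_filter ?x0 //=.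
    by rewrite big_filter_cond; congr (_ + _); apply: eq_bigl => z; rewrite andbC.
  have sizeE : \sum_(z <- s) (1 : C) = M%:R.
    by rewrite big_const_seq count_predT iter_addr_0.
  rewrite /P split2 mul0r phi0 subr0 expi0.
  apply: le_trans (ler_normD _ _) _.
  have rest : `|\sum_(z <- s | (z != 0) && (z != x)) expi (z * t - phi z)| <= M%:R - 2.
    apply: le_trans (ler_norm_sum _ _ _) _.
    under eq_bigr do rewrite norm_expi.
    by rewrite -sizeE split2 -[2]/(1 + 1 : C) [X in X - _]addrC addrK.
  apply: le_trans (lerD (norm1Dexpi_le (ltW e0) ex) rest) _.
  by rewrite -/k !rmorphB !rmorph_nat addrC addrA subrK.
have count p : (M ^ p)%:R <= p.+1%:R ^+ M * (M%:R - k) ^+ p.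
  pose N (f : {ffun 'I_p -> 'I_M}) := \sum_i s`_(f i).
  pose Phi (f : {ffun 'I_p -> 'I_M}) := \sum_i phi s`_(f i).
  pose mult (f : {ffun 'I_p -> 'I_M}) (l : 'I_M) := #|[pred i | f i == l]|.
  have multE (h : R -> R) (f : {ffun 'I_p -> 'I_M}) :
      \sum_i h s`_(f i) = \sum_(l < M) h s`_l *+ mult f l.
    rewrite (partition_big f xpredT) //=; apply: eq_bigr => l _.
    by rewrite (eq_bigr (fun=> h s`_l)) ?sumr_const // => i /eqP ->.
  (* Since [phi] respects relations, terms of [P ^+ p] with equal frequency have equal phase and add
     up without cancellation. *)
  have NPhi (f g : {ffun 'I_p -> 'I_M}) : N f = N g -> Phi f = Phi g.
    pose c x : int := \sum_(l < M | s`_l == x) ((mult f l)%:Z - (mult g l)%:Z).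
    have cE (h : R -> R) : \sum_(x <- s) h x *~ c x =
        \sum_i h s`_(f i) - \sum_i h s`_(g i).
      rewrite !multE -sumrB (big_nth 0) big_mkord; apply: eq_bigr => l _.
      rewrite /c (big_pred1 l) ?mulrzBr // => l'.
      by rewrite nth_uniq.
    move=> E; apply/eqP; rewrite -subr_eq0 -cE; apply/eqP/sP.
    by rewrite (cE id); apply/eqP; rewrite subr_eq0; apply/eqP.
  have Ppow t : P t ^+ p = \sum_(f : {ffun 'I_p -> 'I_M}) expi (N f * t - Phi f).
    have -> : P t ^+ p = \prod_(i < p) \sum_(l < M) expi (s`_l * t - phi s`_l).
      by rewrite prodr_const card_ord /P (big_nth 0) big_mkord.
    rewrite bigA_distr_bigA /=; apply: eq_bigr => f _.
    by rewrite -expi_sum sumrB -mulr_suml.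
  (* A unimodular factor moves the frequency [N f0] to 0 and turns its coefficients into 1, so that
     [norm_mean_le] bounds the size of the group. *)
  have coef (f0 : {ffun 'I_p -> 'I_M}) :
      (#|[pred f | N f == N f0]|)%:R <= ((M%:R - k) ^+ p)%:C :> C.
    have := @norm_mean_le R _
      (fun f : {ffun 'I_p -> 'I_M} => expi (Phi f0 - Phi f)) (fun f => N f - N f0)
      (((M%:R - k) ^+ p)%:C).
    rewrite (eq_bigr (fun=> 1)) => [|f]; last first.
      by rewrite subr_eq0 => /eqP/NPhi ->; rewrite subrr expi0.
    rewrite (eq_bigl (mem [pred f | N f == N f0])) => [|f]; last by rewrite inE subr_eq0.
    rewrite sumr_const normr_nat; apply=> t.
    have -> : \sum_i expi (Phi f0 - Phi i) * expi ((N i - N f0) * t) =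
        expi (Phi f0 - N f0 * t) * P t ^+ p.
      rewrite Ppow mulr_sumr; apply: eq_bigr => f _; rewrite -!expiD; congr expi; ring.
    rewrite normrM norm_expi mul1r normrX rmorphXn.
    by rewrite lerXn2r ?nnegrE // (le_trans _ (PB t)).
  rewrite -lecR rmorphM rmorph_nat.
  (* [cl f] records how often each index occurs; it determines [N f] and takes at most (p+1)^M
     values. *)
  pose cl (f : {ffun 'I_p -> 'I_M}) : {ffun 'I_M -> 'I_p.+1} :=
    [ffun l => inord (mult f l)].
  have clN (f g : {ffun 'I_p -> 'I_M}) : cl f = cl g -> N f = N g.
    move=> E; rewrite /N !(multE id); apply: eq_bigr => l _; congr (_ *+ _).
    have := congr1 (fun u : {ffun 'I_M -> 'I_p.+1} => val (u l)) E.
    rewrite !ffunE /= !inordK // ltnS /mult.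
      by apply: leq_trans (max_card _) _; rewrite card_ord.
    by apply: leq_trans (max_card _) _; rewrite card_ord.
  have -> : (M ^ p)%:R = \sum_(f : {ffun 'I_p -> 'I_M}) (1 : C).
    by rewrite sumr_const card_ffun !card_ord.
  rewrite (partition_big cl xpredT) //=.
  have -> : (p.+1%:R ^+ M)%:C * ((M%:R - k) ^+ p)%:C =
      \sum_(u : {ffun 'I_M -> 'I_p.+1}) ((M%:R - k) ^+ p)%:C :> C.
    rewrite sumr_const card_ffun !card_ord -[RHS]mulr_natl natrX.
    by rewrite [(p.+1%:R ^+ M)%:C]rmorphXn rmorph_nat.
  apply: ler_sum => u _.
  have [f0 /eqP cf0|nof] := pickP (fun f : {ffun 'I_p -> 'I_M} => cl f == u).
    apply: le_trans (coef f0); rewrite sumr_const ler_nat.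
    apply/subset_leq_card/fintype.subsetP => f; rewrite !inE => cf.
    by apply/eqP/clN; rewrite cf0; apply/eqP.
  by rewrite big_pred0 // rmorphXn exprn_ge0 // (le_trans _ (PB 0)).
have B0 : 0 <= M%:R - k by rewrite -ler0c (le_trans _ (PB 0)).
have M0 : 0 < M%:R :> R by rewrite ltr0n /M; case: (s) s0.
have kM : 0 < k / M%:R by rewrite divr_gt0.
(* For this [p], (p+1)^M is below (1 + k/M)^p, while (1 + k/M)(M - k) = M - k^2/M is below M; this
   contradicts [count p]. *)
have [p pM] := poly_lt_exp M kM.
have := count p; apply/negP; rewrite -ltNge natrX.
have [B00|Bn0] := eqVneq (M%:R - k) 0.
  case: p pM => [|p] pM; first by move: pM; rewrite expr0 expr1n ltxx.
  by rewrite B00 expr0n /= mulr0 exprn_gt0.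
have Bp : 0 < M%:R - k by rewrite lt_def Bn0.
apply: lt_le_trans (_ : ((1 + k / M%:R) * (M%:R - k)) ^+ p <= _).
  by rewrite exprMn ltr_pM2r ?exprn_gt0.
apply: lerXn2r.
- by rewrite nnegrE mulr_ge0 ?(ltW Bp) // addr_ge0 // ltW.
- by rewrite nnegrE ltW.
rewrite -subr_ge0 (_ : _ - _ = k ^+ 2 / M%:R); last by field; rewrite gt_eqF.
by rewrite divr_ge0 ?exprn_ge0 ?ltW.
Qed.

End Kronecker.

Lemma rel_preserving_sub (R : realType) (s s' : seq R) (phi : R -> R) :
  uniq s -> uniq s' -> {subset s <= s'} -> rel_preserving s' phi -> rel_preserving s phi.
Proof.
move=> us us' ss' sP c rel.
pose c' x := if x \in s then c x else 0.
have E (f : R -> R) : \sum_(x <- s') f x *~ c' x = \sum_(x <- s) f x *~ c x.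
  rewrite (bigID (mem s)) /= [X in _ + X]big1 ?addr0; last first.
    by move=> x /negPf xs; rewrite /c' xs mulr0z.
  rewrite -big_filter (perm_big s) /=; last first.
    apply: uniq_perm; rewrite ?filter_uniq // => x; rewrite mem_filter.
    by apply/andP/idP => [[]//|xs]; rewrite ss'.
  by apply: eq_big_seq => x xs; rewrite /c' xs.
by rewrite -E; apply: sP; rewrite (E id).
Qed.

(** * Independent frequencies from logarithms of primes *)

Lemma exists_primes (N : nat) : exists ps : seq nat,
  [/\ size ps = N, uniq ps & all prime ps].
Proof.
elim: N => [|N [ps [sN us ps_prime]]]; first by exists [::].
have [p pm p_prime] := prime_above (\max_(q <- ps) q).
exists (p :: ps); split=> /=; rewrite ?sN ?us ?p_prime ?ps_prime ?andbT //.
by apply/negP => pps; move: pm; rewrite ltnNge leq_bigmax_seq.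
Qed.

Lemma logn_prod_primes (ps : seq nat) (a : nat -> nat) p :
  all prime ps -> uniq ps -> p \in ps -> logn p (\prod_(q <- ps) q ^ a q) = a p.
Proof.
move=> ps_prime us pps.
have logE : logn p (\prod_(q <- ps) q ^ a q) = (\sum_(q <- ps) (p == q) * a q)%N.
  elim: {us pps} ps ps_prime => [|q ps IH] /=; first by rewrite !big_nil logn1.
  move=> /andP[q_prime ps_prime]; rewrite !big_cons lognM ?expn_gt0 ?(prime_gt0 q_prime) //.
    by rewrite IH // lognX logn_prime // mulnC.
  rewrite big_seq; apply: prodn_cond_gt0 => r /(allP ps_prime)/prime_gt0 r0.
  by rewrite expn_gt0 r0.
rewrite logE (bigD1_seq p) //= eqxx mul1n big1 ?addn0 // => q.
by rewrite eq_sym => /negPf ->.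
Qed.

Section LogPrimes.
Variable R : realType.

(** Unique factorization: exponentiating the relation, with negative coefficients moved to the other
    side, equates two products of prime powers, whose valuations must agree. *)
Lemma ln_primes_free (ps : seq nat) (c : nat -> int) : all prime ps -> uniq ps ->
  \sum_(p <- ps) ln p%:R *~ c p = 0 :> R -> {in ps, forall p, c p = 0}.
Proof.
move=> ps_prime us rel p pps.
pose a p := if 0 <= c p then `|c p|%N else 0%N.
pose b p := if 0 <= c p then 0%N else `|c p|%N.
have cE q : c q = (a q)%:Z - (b q)%:Z.
  by rewrite /a /b; case: leP => cq; lia.
have expE (d : nat -> nat) :
    expR (\sum_(q <- ps) ln q%:R *+ d q) = (\prod_(q <- ps) q ^ d q)%:R :> R.
  rewrite (big_morph _ (@expRD R) (@expR0 R)) natr_prod.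
  apply: eq_big_seq => q /(allP ps_prime)/prime_gt0 q0.
  by rewrite -[_ *+ d q]mulr_natr expRM_natr lnK ?natrX // posrE ltr0n.
have E : (\prod_(q <- ps) q ^ a q)%N = (\prod_(q <- ps) q ^ b q)%N.
  apply/eqP; rewrite -(eqr_nat R) -!expE; apply/eqP; congr expR; apply/eqP.
  rewrite -subr_eq0 -sumrB -{2}rel; apply/eqP/eq_bigr => q _.
  by rewrite cE mulrzBr.
rewrite cE -(logn_prod_primes a ps_prime us pps) E (logn_prod_primes b) //.
by rewrite subrr.
Qed.

(** Logarithms of distinct primes have only the trivial integer relation, which every [phi]
    preserves. *)
Lemma exists_free_frequencies (N : nat) : exists s : seq R,
  [/\ size s = N, uniq s, {in s, forall x, 0 < x} & forall phi, rel_preserving s phi].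
Proof.
have [ps [sN us ps_prime]] := exists_primes N.
have inj : {in ps &, injective (fun p : nat => ln p%:R : R)}.
  move=> p q /(allP ps_prime)/prime_gt0 p0 /(allP ps_prime)/prime_gt0 q0 /ln_inj E.
  by apply/eqP; rewrite -(eqr_nat R) E ?posrE ?ltr0n.
exists [seq ln p%:R | p <- ps]; split; first by rewrite size_map.
- by rewrite map_inj_in_uniq.
- by move=> _ /mapP[p /(allP ps_prime)/prime_gt1 p1 ->]; rewrite ln_gt0 // ltr1n.
move=> phi c; rewrite !big_map => rel; apply: big1_seq => p /= pps.
by rewrite (ln_primes_free (c := fun p => c (ln p%:R)) ps_prime us rel) ?mulr0z.
Qed.

End LogPrimes.

(** * Continuity of the complex exponential *)

Section ComplexContinuity.
Variable R : realType.
Local Notation C := R[i].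

Lemma gt0_complexE (e : C) : 0 < e -> e = (complex.Re e)%:C /\ 0 < complex.Re e.
Proof. by case: e => a b; rewrite ltcE /= => /andP[/eqP-> ?]. Qed.

Lemma norm_Im_le (z : C) : `|complex.Im z|%:C <= `|z|.
Proof.
by case: z => a b; rewrite normc_def lecR -sqrtr_sqr ler_wsqrtr //= lerDr sqr_ge0.
Qed.

Lemma continuous_Re : continuous (@complex.Re R : C -> R).
Proof.
move=> z; have FF : Filter (nbhs z) := nbhs_filter z.
apply: (iffRL (@cvgrPdist_lt R R C (nbhs z) FF _ _)) => e e0.
have e0C : 0 < e%:C :> C by rewrite ltcR.
apply/nbhs_ballP; exists e%:C => // w; rewrite -ball_normE /= => zw.
by rewrite -ltcR; apply: le_lt_trans zw; rewrite -raddfB normc_ge_Re.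
Qed.

Lemma continuous_Im : continuous (@complex.Im R : C -> R).
Proof.
move=> z; have FF : Filter (nbhs z) := nbhs_filter z.
apply: (iffRL (@cvgrPdist_lt R R C (nbhs z) FF _ _)) => e e0.
have e0C : 0 < e%:C :> C by rewrite ltcR.
apply/nbhs_ballP; exists e%:C => // w; rewrite -ball_normE /= => zw.
by rewrite -ltcR; apply: le_lt_trans zw; rewrite -raddfB norm_Im_le.
Qed.

Lemma continuous_real_complex : continuous (fun x : R => x%:C : C).
Proof.
move=> x; apply/cvgrPdist_lt => e /gt0_complexE[-> e0].
apply/nbhs_ballP; exists (complex.Re e) => // y /= xy.
by rewrite -rmorphB normc_def /= expr0n addr0 sqrtr_sqr ltcR.
Qed.

Lemma continuous_cexp (T : topologicalType) (f : T -> C) :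
  continuous f -> continuous (fun x => cexp (f x)).
Proof.
move=> cf.
have cRe : continuous (fun x => complex.Re (f x)).
  by move=> x; exact: (continuous_comp (cf x) (@continuous_Re (f x))).
have cIm : continuous (fun x => complex.Im (f x)).
  by move=> x; exact: (continuous_comp (cf x) (@continuous_Im (f x))).
have compR (g : R -> R) (h : T -> R) : continuous g -> continuous h ->
    continuous (fun x => (g (h x))%:C : C).
  move=> cg ch x; have cgh : {for x, continuous (g \o h)}.
    exact: (continuous_comp (ch x) (cg _)).
  exact: (continuous_comp cgh (@continuous_real_complex _)).
have cexpE (z : C) : cexp z = (expR (complex.Re z))%:C *
    ((cos (complex.Im z))%:C + 'i * (sin (complex.Im z))%:C).
  by rewrite /cexp; congr (_ * _); simpc.
rewrite (funext (fun x => cexpE (f x))) => x.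
apply: cvgM; first by apply: compR => //; exact: continuous_expR.
apply: cvgD; first by apply: compR => //; exact: continuous_cos.
apply: cvgM; first exact: cvg_cst.
by apply: compR => //; exact: continuous_sin.
Qed.

End ComplexContinuity.

(** * Zeros of maps on the half torus *)

Section TorusZero.
Variables (R : realType) (n : nat).
Local Notation C := R[i].
Local Notation angles := ('I_(n + n) -> R).

Definition half_torus (theta : angles) := forall i, - (pi / 2) <= theta i <= pi / 2.

Definition sinC (j : 'I_n) (theta : angles) : C :=
  sin (theta (lshift n j)) +i* sin (theta (rshift n j)).

(** The condition [sin (theta i) ^+ 2 = 1] singles out the faces of the cube. There the
    corresponding real coordinate of [sinC] is 1 or -1, and a perturbation smaller than 1 keeps its
    sign, so Poincare-Miranda applies to the 2n real coordinates of [G]. *)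
Lemma torus_zero (G : 'I_n -> angles -> C) (L : R) : 0 <= L ->
  (forall j theta theta' (d : R), (forall i, `|theta i - theta' i| <= d) ->
      `|G j theta - G j theta'| <= (L * d)%:C) ->
  (forall theta, half_torus theta -> (exists i, sin (theta i) ^+ 2 = 1) ->
     forall j, `|G j theta - sinC j theta| < 1) ->
  forall e, 0 < e -> exists2 theta, half_torus theta & forall j, `|G j theta| < e%:C.
Proof.
move=> L0 GL Gbd e e0.
pose F (i : 'I_(n + n)) theta := match fintype.split i with
  | inl j => complex.Re (G j theta) | inr j => complex.Im (G j theta) end.
have Fl j theta : F (lshift n j) theta = complex.Re (G j theta).
  by rewrite /F -[lshift n j]/(unsplit (inl _ j)) unsplitK.
have Fr j theta : F (rshift n j) theta = complex.Im (G j theta).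
  by rewrite /F -[rshift n j]/(unsplit (inr _ j)) unsplitK.
have Fnear i theta : half_torus theta -> (exists i, sin (theta i) ^+ 2 = 1) ->
    `|F i theta - sin (theta i)| < 1.
  move=> ht bd; rewrite -(splitK i); case: fintype.split => j /=;
    rewrite ?Fl ?Fr -ltcR; apply: le_lt_trans (Gbd _ ht bd j).
    by rewrite -[sin _]/(complex.Re (sinC j theta)) -raddfB normc_ge_Re.
  by rewrite -[sin _]/(complex.Im (sinC j theta)) -raddfB norm_Im_le.
have pi2 : - (pi / 2) < pi / 2 :> R by rewrite gtrN // divr_gt0 ?pi_gt0.
have e2 : 0 < e / 2 by rewrite divr_gt0.
have PM : exists2 theta, half_torus theta & forall i, `|F i theta| < e / 2.
  apply: (poincare_miranda pi2 _ _ _ e2) => [d d0|theta i ht ti|theta i ht ti].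
  - exists (d / (L + 1)); first by rewrite divr_gt0 // ltr_wpDl.
    move=> theta theta' _ _ dist i; apply: (@le_lt_trans _ _ (L * (d / (L + 1)))).
      rewrite -(splitK i) -lecR; case: fintype.split => j /=; rewrite ?Fl ?Fr -raddfB.
        exact: le_trans (normc_ge_Re _) (GL _ _ _ _ dist).
      exact: le_trans (norm_Im_le _) (GL _ _ _ _ dist).
    by rewrite mulrCA gtr_pMr // ltr_pdivrMr ?mul1r ?ltrDl // ltr_wpDl.
  - have : `|F i theta - sin (theta i)| < 1.
      by apply: Fnear => //; exists i; rewrite ti sinN sin_pihalf sqrrN expr1n.
    by rewrite ti sinN sin_pihalf ltr_norml; lra.
  - have : `|F i theta - sin (theta i)| < 1.
      by apply: Fnear => //; exists i; rewrite ti sin_pihalf expr1n.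
    by rewrite ti sin_pihalf ltr_norml; lra.
have [theta ht Fe] := PM.
exists theta => // j; apply: le_lt_trans (norm_le_ReIm _) _.
by rewrite ltcR -Fl -Fr [e]splitr ltrD.
Qed.

End TorusZero.

(** * A Lipschitz cutoff vanishing on the faces of the cube *)

Section Cutoff.
Variables (R : realType) (n : nat).
Local Notation C := R[i].
Local Notation angles := ('I_(n + n) -> R).

Definition sin2sum (theta : angles) : R := \sum_i sin (theta i) ^+ 2.

(** Where positive, this is the value at [theta] that corresponds to [g] in
    [exists_irreducible_tuple]. *)
Definition cutoff (theta : angles) : R := Num.max (1 - sin2sum theta) 0.

Lemma cutoff_ge0 theta : 0 <= cutoff theta.
Proof. by rewrite le_max lexx orbT. Qed.

Lemma sin2sum_ge0 theta : 0 <= sin2sum theta.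
Proof. by apply: sumr_ge0 => i _; rewrite sqr_ge0. Qed.

Lemma cutoff_le1 theta : cutoff theta <= 1.
Proof. by rewrite ge_max ler01 andbT lerBlDr lerDl sin2sum_ge0. Qed.

Lemma lipschitz_sqr_sin (x y : R) : `|sin x ^+ 2 - sin y ^+ 2| <= 2 * `|x - y|.
Proof.
rewrite subr_sqr normrM mulrC ler_pM ?lipschitz_sin //.
apply: le_trans (ler_normD _ _) _.
by rewrite (_ : 2 = 1 + 1) ?lerD ?sin_max.
Qed.

Lemma lipschitz_cutoff theta theta' (d : R) : (forall i, `|theta i - theta' i| <= d) ->
  `|cutoff theta - cutoff theta'| <= (n + n)%:R * (2 * d).
Proof.
move=> dist; have : `|sin2sum theta - sin2sum theta'| <= (n + n)%:R * (2 * d).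
  rewrite -sumrB; apply: le_trans (ler_norm_sum _ _ _) _.
  rewrite mulr_natl -[X in _ *+ X]card_ord -sumr_const; apply: ler_sum => i _.
  by apply: le_trans (lipschitz_sqr_sin _ _) _; rewrite ler_wpM2l.
apply: le_trans; rewrite /cutoff.
set u := sin2sum theta; set v := sin2sum theta'.
have uv := ler_norm (u - v); have vu := ler_norm (v - u); rewrite distrC in vu.
by rewrite ler_norml; case: (leP (1 - u) 0) => ?; case: (leP (1 - v) 0) => ?;
  apply/andP; split; lra.
Qed.

Lemma lipschitz_sinC (j : 'I_n) theta theta' (d : R) :
  (forall i, `|theta i - theta' i| <= d) ->
  `|sinC j theta - sinC j theta'| <= (2 * d)%:C.
Proof.
move=> dist; apply: le_trans (norm_le_ReIm _) _.
rewrite lecR (_ : 2 * d = d + d); last by ring.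
by rewrite lerD //; apply: le_trans (lipschitz_sin _ _) (dist _).
Qed.

End Cutoff.

(** * Almost periodic functions near a torus *)

Section AlmostPeriodic.
Variables (R : realType) (X : ptopologicalType) (emb : X -> R[i]).
Local Notation C := R[i].
Local Notation A := (AP emb).

Hypothesis emb_cont : continuous emb.
Hypothesis emb_ge0 : forall x, 0 <= complex.Im (emb x).
(** This treats both algebras at once: on the line the point [t] itself serves, in the half-plane a
    point slightly above it. *)
Hypothesis emb_dense : forall (s : seq R) (t e : R), {in s, forall mu : R, 0 <= mu} ->
  0 < e -> exists x, forall mu, mu \in s ->
  `|cexp ('i * mu%:C * emb x) - expi (mu * t)| < e%:C.

Definition ev (x : X) (f : A) : C := AP_val f x.

Lemma evD x f g : ev x (f + g) = ev x f + ev x g. Proof. by []. Qed.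
Lemma evB x f g : ev x (f - g) = ev x f - ev x g. Proof. by []. Qed.
Lemma evM x f g : ev x (f * g) = ev x f * ev x g. Proof. by []. Qed.
Lemma evZ x (a : C) f : ev x (a *: f) = a * ev x f. Proof. by []. Qed.
Lemma ev0 x : ev x 0 = 0. Proof. by []. Qed.
Lemma ev1 x : ev x 1 = 1. Proof. by []. Qed.

Lemma ev_sum x (I : Type) (r : seq I) (P : pred I) (F : I -> A) :
  ev x (\sum_(i <- r | P i) F i) = \sum_(i <- r | P i) ev x (F i).
Proof. exact: (big_morph (ev x) (evD x) (ev0 x)). Qed.

Lemma norm_ev x f : `|ev x f| <= `|f|.
Proof. exact: supnorm_ub. Qed.

Lemma norm_cexp_le1 mu x : 0 <= mu -> `|cexp ('i * mu%:C * emb x)| <= 1.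
Proof.
move=> mu0; rewrite /cexp normrM.
set w := 'i * mu%:C * emb x.
have -> : `|cos (complex.Im w) +i* sin (complex.Im w)| = 1 :> C.
  by rewrite normc_def /= cos2Dsin2 sqrtr1.
rewrite mulr1 normc_def /= expr0n addr0 sqrtr_sqr lecR ger0_norm ?expR_ge0 //.
rewrite -expR0 ler_expR /w; have := emb_ge0 x; case: (emb x) => a b /= b0.
by simpc; rewrite /= oppr_le0 mulr_ge0.
Qed.

Lemma exists_char mu : 0 <= mu ->
  exists f : A, forall x, ev x f = cexp ('i * mu%:C * emb x).
Proof.
move=> mu0.
have bE : (fun x => cexp ('i * mu%:C * emb x)) \in bcont R X.
  apply/bcontP; split; last by exists 1 => x; exact: norm_cexp_le1.
  apply: continuous_cexp => x; apply: cvgM; first exact: cvg_cst.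
  exact: emb_cont.
have eE : MkCb bE \in ap_pred emb.
  apply/mem_set/subset_closure; exists 1%N, (fun=> 1), (fun=> mu); split=> // x.
  by rewrite big_ord1 mul1r.
by exists (MkAP eE).
Qed.

Lemma ap_approx (f : A) (e : C) : 0 < e -> exists s : seq (C * R),
  {in s, forall p, 0 <= p.2} /\
  forall x, `|ev x f - \sum_(p <- s) p.1 * cexp ('i * p.2%:C * emb x)| < e.
Proof.
move=> e0; have := valP f; rewrite inE => /(_ (ball (AP_val f) e)).
case; first exact: nbhsx_ballx.
move=> q [[n [a [l [_ l0 qE]]]]]; rewrite -ball_normE /= => fq.
exists [seq (a j, l j) | j <- enum 'I_n]; split=> [_ /mapP[j _ ->]|x]; first exact: l0.
rewrite big_map big_enum -qE; apply: le_lt_trans fq.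
exact: (supnorm_ub (AP_val f - q) x).
Qed.


(* The characters of A used here send the frequencies al i and be i to theta i
   and - theta i; they are limits of evaluations by Kronecker's theorem, hence
   send S i to sin (theta i). *)
Lemma exists_torus (m : nat) : exists S : 'I_m -> A,
  forall (n : nat) (a : 'I_n -> A) (eta : R), 0 < eta ->
  exists (ah : 'I_n -> ('I_m -> R) -> C) (L : R), [/\ 0 <= L,
    forall j theta theta' (d : R), (forall i, `|theta i - theta' i| <= d) ->
      `|ah j theta - ah j theta'| <= (L * d)%:C &
    forall theta (e : R), 0 < e -> exists x : X,
      (forall i, `|ev x (S i) - (sin (theta i))%:C| < e%:C) /\
      forall j, `|ev x (a j) - ah j theta| < eta%:C].
Proof.
have [s0 [sz us s_gt0 s_free]] := exists_free_frequencies R (m + m).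
pose al (i : 'I_m) := s0`_i; pose be (i : 'I_m) := s0`_(m + i).
have al_s i : al i \in s0 by rewrite mem_nth // sz ltn_addr.
have be_s i : be i \in s0 by rewrite mem_nth // sz ltn_add2l.
have al_inj i j : (al i == al j) = (i == j).
  by rewrite nth_uniq ?sz ?ltn_addr.
have be_inj i j : (be i == be j) = (i == j).
  by rewrite nth_uniq ?sz ?ltn_add2l // eqn_add2l.
have al_be i j : al i != be j.
  by rewrite nth_uniq ?sz ?ltn_add2l ?ltn_addr // neq_ltn ltn_addr.
have S_ex i : exists f : A, forall x, ev x f = (2 * 'i)^-1 *
    (cexp ('i * (al i)%:C * emb x) - cexp ('i * (be i)%:C * emb x)).
  have [f fE] := exists_char (ltW (s_gt0 _ (al_s i))).
  have [g gE] := exists_char (ltW (s_gt0 _ (be_s i))).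
  by exists ((2 * 'i)^-1 *: (f - g)) => x; rewrite evZ evB fE gE.
have {S_ex}[S SE] := choice S_ex.
exists S => n a eta eta0.
have eta2 : 0 < (eta / 2)%:C :> C by rewrite ltcR divr_gt0 // ltr0n.
have [r rE] := choice (fun j => ap_approx (a j) eta2).
(* All frequencies of the [S i] and of the approximants of the [a j], with 0 added for
   [kronecker]. *)
pose T := undup (s0 ++ 0 :: flatten [seq [seq p.2 | p <- r j] | j <- enum 'I_n]).
have uT : uniq T by exact: undup_uniq.
have T_s0 : {subset s0 <= T} by move=> x xs; rewrite mem_undup mem_cat xs.
have T0 : 0 \in T by rewrite mem_undup mem_cat mem_head orbT.
have T_r j p : p \in r j -> p.2 \in T.
  move=> pr; rewrite mem_undup mem_cat inE; apply/orP; right; apply/orP; right.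
  apply/flattenP; exists [seq p.2 | p <- r j]; last exact: map_f.
  by apply: map_f; rewrite mem_enum.
have T_ge0 : {in T, forall mu, 0 <= mu}.
  move=> mu; rewrite mem_undup mem_cat inE => /or3P[/s_gt0/ltW//|/eqP->//|].
  by move=> /flattenP[_ /mapP[j _ ->] /mapP[p pr ->]]; exact: (rE j).1.
(* Extending one coordinate homomorphism for each [i], instead of one homomorphism for each [theta],
   makes [Phi] linear in [theta] and hence every [ah j] Lipschitz. *)
have phi_ex i : exists phi : R -> R, rel_preserving T phi /\
    forall j, phi (al j) = (j == i)%:R /\ phi (be j) = - (j == i)%:R.
  pose phi0 x : R := if x == al i then 1 else if x == be i then -1 else 0.
  have [s' [phi [us' _ Ts' phiE phiP]]] := rel_preserving_extend T us (s_free phi0).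
  exists phi; split; first exact: rel_preserving_sub phiP.
  move=> j; rewrite !phiE // /phi0 al_inj be_inj (negPf (al_be j i)).
  by rewrite [be j == _]eq_sym (negPf (al_be i j)); case: (j == i); rewrite ?oppr0.
have {phi_ex}[phi phiP] := choice phi_ex.
pose Phi theta x := \sum_i theta i * phi i x.
have PhiP theta : rel_preserving T (Phi theta).
  move=> c rel; under eq_bigr do rewrite mulrz_suml.
  rewrite exchange_big big1 // => i _ /=.
  under eq_bigr do rewrite -mulrzAr.
  by rewrite -mulr_sumr (phiP i).1 // mulr0.
have Phi_al theta i : Phi theta (al i) = theta i.
  rewrite /Phi (bigD1 i) //= ((phiP i).2 i).1 eqxx mulr1 big1 ?addr0 // => j ji.
  by rewrite ((phiP j).2 i).1 eq_sym (negPf ji) mulr0.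
have Phi_be theta i : Phi theta (be i) = - theta i.
  rewrite /Phi (bigD1 i) //= ((phiP i).2 i).2 eqxx mulrN1 big1 ?addr0 // => j ji.
  by rewrite ((phiP j).2 i).2 eq_sym (negPf ji) oppr0 mulr0.
pose nr (z : C) := complex.Re `|z|.
have nrE z : (nr z)%:C = `|z| by exact: ReK_ge0 (normr_ge0 z).
have nr0 z : 0 <= nr z by rewrite -ler0c nrE.
pose K := \sum_j \sum_(p <- r j) nr p.1.
have K_ge0 : 0 <= K by apply: sumr_ge0 => j _; apply: sumr_ge0.
have K_ge j : \sum_(p <- r j) nr p.1 <= K.
  by rewrite /K (bigD1 j) //= lerDl; apply: sumr_ge0 => l _; apply: sumr_ge0.
pose Lp (mu : R) := 2 * \sum_i `|phi i mu|.
have Lp0 mu : 0 <= Lp mu by rewrite mulr_ge0 // sumr_ge0.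
exists (fun j theta => \sum_(p <- r j) p.1 * expi (Phi theta p.2)),
  (\sum_j \sum_(p <- r j) nr p.1 * Lp p.2); split.
- by apply: sumr_ge0 => j _; apply: sumr_ge0 => p _; rewrite mulr_ge0.
- move=> j theta theta' d dist; rewrite -sumrB.
  apply: (@le_trans _ _ (\sum_(p <- r j) nr p.1 * Lp p.2 * d)%:C).
    rewrite rmorph_sum; apply: le_trans (ler_norm_sum _ _ _) _.
    apply: ler_sum => p _; rewrite -mulrBr normrM -nrE -mulrA rmorphM ler_wpM2l ?ler0c //.
    apply: le_trans (lipschitz_expi _ _) _; rewrite lecR /Lp -mulrA ler_wpM2l //.
    rewrite /Phi -sumrB mulr_suml; apply: le_trans (ler_norm_sum _ _ _) _.
    by apply: ler_sum => i _; rewrite -mulrBl normrM mulrC ler_wpM2l.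
  rewrite lecR -mulr_suml.
  (* For [m = 0] nothing forces [d] to be nonnegative, but then every [Lp] is 0. *)
  have [i _|m0] := pickP (fun i : 'I_m => true).
    have d0 : 0 <= d by apply: le_trans (dist i).
    apply: ler_wpM2r => //; rewrite (bigD1 j) //= lerDl.
    by apply: sumr_ge0 => l _; apply: sumr_ge0 => p _; rewrite mulr_ge0.
  rewrite !big1 ?mul0r // => [l|p] _; last first.
    by rewrite /Lp big1 ?mulr0 // => i; have := m0 i.
  by rewrite big1 // => p _; rewrite /Lp big1 ?mulr0 // => i; have := m0 i.
move=> theta e e0.
(* Every exponential will be off by at most [2 * e']. The coefficients of an approximant have total
   size at most [K], so this costs at most [eta / 2], besides the [eta / 2] of the approximation
   itself. *)
pose e' := Num.min (e / 4) (eta / (4 * (K + 1))).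
have e'0 : 0 < e'.
  by rewrite lt_min !divr_gt0 // mulr_gt0 // ltr_wpDl.
have [t tE] := kronecker uT T0 (PhiP theta) e'0.
have [x xE] := emb_dense t T_ge0 e'0.
have close mu : mu \in T ->
    `|cexp ('i * mu%:C * emb x) - expi (Phi theta mu)| <= (2 * e')%:C.
  move=> muT; rewrite -(subrKA (expi (mu * t))); apply: le_trans (ler_normD _ _) _.
  rewrite (_ : 2 * e' = e' + e'); last by ring.
  by rewrite rmorphD lerD //; apply: ltW; [exact: xE|exact: tE].
exists x; split=> [i|j].
  have -> : (sin (theta i))%:C = (2 * 'i)^-1 * (expi (theta i) - expi (- theta i)) :> C.
    have i2 : 2 * 'i != 0 :> C.
      by rewrite mulf_neq0 // ?pnatr_eq0 // -sqrf_eq0 sqr_i oppr_eq0 oner_eq0.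
    apply: (mulfI i2); rewrite mulrA divff ?mul1r //.
    rewrite !expiE cosN sinN mulr_natl mulr2n; simpc.
    by rewrite mulrDl mul1r.
  rewrite SE -mulrBr normrM.
  have -> : `|(2 * 'i)^-1| = 2^-1 :> C.
    rewrite normfV normrM ger0_norm ?ler0n //.
    by rewrite normc_def /= expr0n expr1n add0r sqrtr1 mulr1.
  rewrite mulrC ltr_pdivrMr ?ltr0n //.
  apply: le_lt_trans (_ : (4 * e')%:C < _); last first.
    rewrite -[2]/(2%:R) -(rmorph_nat (real_complex R)) -rmorphM ltcR.
    have : e' <= e / 4 by rewrite /e' ge_min lexx.
    lra.
  have cA := close _ (T_s0 _ (al_s i)); rewrite Phi_al in cA.
  have cB := close _ (T_s0 _ (be_s i)); rewrite Phi_be in cB.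
  have sub4 (a1 b1 u v : C) : a1 - b1 - (u - v) = (a1 - u) - (b1 - v) by ring.
  rewrite sub4.
  apply: le_trans (ler_normB _ _) _.
  rewrite (_ : 4 * e' = 2 * e' + 2 * e') ?rmorphD ?lerD //.
  by ring.
have e'K : e' * (4 * (K + 1)) <= eta.
  by rewrite -ler_pdivlMr ?mulr_gt0 ?ltr_wpDl // /e' ge_min lexx orbT.
rewrite -(subrKA (\sum_(p <- r j) p.1 * cexp ('i * p.2%:C * emb x))).
apply: le_lt_trans (ler_normD _ _) _.
rewrite [eta]splitr rmorphD ltr_leD ?(rE j).2 //.
rewrite -sumrB; apply: le_trans (ler_norm_sum _ _ _) _.
apply: (@le_trans _ _ (K * (2 * e'))%:C); last by rewrite lecR; lra.
apply: (@le_trans _ _ ((\sum_(p <- r j) nr p.1) * (2 * e'))%:C); last first.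
  by rewrite lecR ler_wpM2r // mulr_ge0 // ltW.
rewrite mulr_suml rmorph_sum big_seq [leRHS]big_seq; apply: ler_sum => p pr.
by rewrite -mulrBr normrM -nrE rmorphM ler_wpM2l ?ler0c // close // (T_r j).
Qed.


(** * Invertible tuples and the topological stable rank *)

Lemma normE (V : normedModType C) (f : V) : exists2 r : R, 0 <= r & `|f| = r%:C.
Proof.
exists (complex.Re `|f|); last by rewrite ReK_ge0.
by rewrite -ler0c ReK_ge0.
Qed.

(** Evaluating the Bezout identity at [x] bounds 1 by [Y] times the sum of moduli; the summand 1 in
    [Y] keeps it positive. *)
Lemma invertible_lower_bound n (F : 'rV[A]_n) : invertible_tuples F ->
  exists2 d : R, 0 < d & forall x, d%:C <= \sum_j `|ev x (F 0 j)|.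
Proof.
move=> [y yF].
have [r rE] := choice (fun j => let: ex_intro2 r r0 E := normE (y 0 j) in
  ex_intro (fun r : R => 0 <= r /\ `|y 0 j| = r%:C) r (conj r0 E)).
pose Y := \sum_j r j + 1.
have Y0 : 0 < Y by rewrite ltr_wpDl // sumr_ge0 // => j _; have [] := rE j.
exists Y^-1; first by rewrite invr_gt0.
move=> x; rewrite -(ler_pM2l (_ : 0 < Y%:C)); last by rewrite ltcR.
rewrite -rmorphM divff ?gt_eqF //.
apply: (@le_trans _ _ `|ev x (\sum_j y 0 j * F 0 j)|); first by rewrite yF ev1 normr1.
rewrite ev_sum.
apply: le_trans (ler_norm_sum _ _ _) _; rewrite mulr_sumr; apply: ler_sum => j _.
rewrite evM normrM ler_wpM2r //; apply: le_trans (norm_ev x _) _.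
rewrite (rE j).2 lecR /Y (bigD1 j) //= -addrA lerDl addr_ge0 //.
by apply: sumr_ge0 => i _; have [] := rE i.
Qed.

Lemma sinC_near n (S : 'I_(n + n) -> A) theta x (e : R) :
  (forall i, `|ev x (S i) - (sin (theta i))%:C| < e%:C) ->
  forall j, `|ev x (S (lshift n j) + 'i *: S (rshift n j)) - sinC j theta| <= (2 * e)%:C.
Proof.
move=> near j; rewrite evD evZ.
have -> : sinC j theta =
    (sin (theta (lshift n j)))%:C + 'i * (sin (theta (rshift n j)))%:C.
  by rewrite [LHS]complexE.
rewrite opprD addrACA -mulrBr; apply: le_trans (ler_normD _ _) _.
rewrite normrM [`|'i|](_ : _ = 1) ?mul1r; last first.
  by rewrite normc_def /= expr0n /= add0r expr1n sqrtr1.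
rewrite (_ : 2 * e = e + e); last by ring.
by rewrite rmorphD lerD // ltW.
Qed.

(** If an invertible [F] were close to [f], its continuous model [ah] would be close to [sinC] on
    the faces, so all [ah j] would be small at some [theta]. A point [x] modelled by [theta] then
    makes all [F 0 j] small, against the lower bound. *)
Lemma not_dense_invertible_tuples n : (0 < n)%N ->
  ~ dense (@invertible_tuples A n : set 'rV[A]_n).
Proof.
move=> n0 dns.
(* Error budget on the faces: 1/4 from [ah] to [F], 1/4 from [F] to [f], and twice 1/8 from [f] to
   [sinC]. *)
have bound : 4^-1 + (4^-1 + 2 * 8^-1) <= 1 :> R by lra.
have n0R : 0 < n%:R :> R by rewrite ltr0n.
have [S SP] := exists_torus (n + n).
pose f j : A := S (lshift n j) + 'i *: S (rshift n j).
have q0 : 0 < (4^-1)%:C :> C by rewrite ltcR invr_gt0 ltr0n.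
have [F [Finv Ff]] : exists F : 'rV[A]_n, invertible_tuples F /\
    forall j, `|f j - F 0 j| < (4^-1)%:C.
  pose O : set 'rV[A]_n := [set F | forall j, ball (f j) (4^-1)%:C (F 0 j)].
  have Of : nbhs (\row_j f j) O.
    exists (fun i j => ball (f j) (4^-1)%:C) => [i j|F FO j]; last exact: FO.
    by rewrite mxE; exact: nbhsx_ballx.
  have O0 : interior O !=set0 by exists (\row_j f j).
  have [F [/interior_subset FO Finv]] := dns _ O0 (@open_interior _ O).
  by exists F; split=> // j; have := FO j; rewrite -ball_normE.
have [d d0 Fd] := invertible_lower_bound Finv.
(* The second bound makes each [F 0 j] at most d/(2n) at the final point, so that the moduli add up
   to at most d/2. *)
pose eta := Num.min 4^-1 (d / (4 * n%:R)).
have eta0 : 0 < eta by rewrite lt_min invr_gt0 ltr0n /= divr_gt0 // mulr_gt0.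
have [ah [L [L0 ahL ahP]]] := SP n (fun j => F 0 j) eta eta0.
have e0 : 0 < d / (4 * n%:R) by rewrite divr_gt0 // mulr_gt0.
have [|theta ht small] := torus_zero L0 ahL _ e0.
  move=> theta ht _ j.
  have [|x [Sx Fx]] := ahP theta 8^-1; first by rewrite invr_gt0 ltr0n.
  have H1 : `|ah j theta - ev x (F 0 j)| < (4^-1)%:C.
    by rewrite distrC; apply: lt_le_trans (Fx j) _; rewrite lecR /eta ge_min lexx.
  have H2 : `|ev x (F 0 j) - ev x (f j)| < (4^-1)%:C.
    by rewrite distrC -evB; exact: le_lt_trans (norm_ev x _) (Ff j).
  have H3 := sinC_near Sx j.
  rewrite -(subrKA (ev x (F 0 j))) -(subrKA (ev x (f j)) (ev x (F 0 j))).
  apply: le_lt_trans (ler_normD _ _) _.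
  apply: (@lt_le_trans _ _ (4^-1 + (4^-1 + 2 * 8^-1))%:C).
    rewrite 2!rmorphD; apply: ltr_leD => //; apply: le_trans (ler_normD _ _) _.
    by apply: lerD => //; exact: ltW.
  by move: bound; rewrite -lecR.
have [x [_ Fx]] := ahP theta 1 ltr01.
have := Fd x; apply/negP; rewrite -real_ltNge ?realE ?ler0c ?(ltW d0) ?sumr_ge0 //.
apply: (@le_lt_trans _ _ (\sum_(j < n) (d / (2 * n%:R))%:C)).
  apply: ler_sum => j _; rewrite -[ev x _](subrK (ah j theta)).
  apply: le_trans (ler_normD _ _) _.
  apply: (@le_trans _ _ (eta%:C + (d / (4 * n%:R))%:C)).
    by rewrite lerD // ltW.
  rewrite -rmorphD lecR.
  have : eta <= d / (4 * n%:R) by rewrite /eta ge_min lexx orbT.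
  have -> : d / (2 * n%:R) = d / (4 * n%:R) + d / (4 * n%:R).
    by field; rewrite gt_eqF.
  by rewrite lerD2r.
rewrite -rmorph_sum sumr_const card_ord ltcR -[X in X < _]mulr_natr.
rewrite (_ : d / (2 * n%:R) * n%:R = d / 2); last by field; rewrite gt_eqF.
by rewrite ltr_pdivrMr // ltr_pMr // ltr1n.
Qed.


(** * The Bass stable rank *)

Lemma norm_sqr_sub_le (z : C) (a e : R) : `|a| <= 1 -> e <= 1 ->
  `|z - a%:C| < e%:C -> `|z ^+ 2 - (a ^+ 2)%:C| <= (3 * e)%:C.
Proof.
move=> a1 e1 za; rewrite rmorphXn subr_sqr normrM mulrC rmorphM.
apply: ler_pM => //; last exact: ltW.
have -> : z + a%:C = (z - a%:C) + (a + a)%:C by rewrite rmorphD; ring.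
apply: le_trans (ler_normD _ _) _.
have -> : 3 = 1 + 2 :> R by ring.
rewrite [X in _ <= X]rmorphD; apply: lerD.
  by apply: le_trans (ltW za) _; rewrite lecR.
rewrite normc_def /= expr0n addr0 sqrtr_sqr lecR.
by apply: le_trans (ler_normD _ _) _; rewrite (_ : 2 = 1 + 1) ?lerD.
Qed.

Lemma exists_irreducible_tuple n : (0 < n)%N ->
  exists2 h : 'rV[A]_(n + 1), invertible_tuples h & ~ reducible h.
Proof.
move=> n0; have n0R : 0 < n%:R :> R by rewrite ltr0n.
have [S SP] := exists_torus (n + n).
pose f j : A := S (lshift n j) + 'i *: S (rshift n j).
(* With this formal conjugate, [y j * f j] is the sum of the squares of the two functions [S] in
   [f j]. So [g] is 1 minus the sum of all squares, and [y] with 1 solves the Bezout equation. *)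
pose y j : A := S (lshift n j) - 'i *: S (rshift n j).
pose g : A := 1 - \sum_j y j * f j.
have g_near theta x (e : R) : e <= 1 ->
    (forall i, `|ev x (S i) - (sin (theta i))%:C| < e%:C) ->
    `|ev x g - (1 - sin2sum theta)%:C| <= ((n + n)%:R * (3 * e))%:C.
  move=> e1 Sx; have -> : ev x g = 1 - \sum_i ev x (S i) ^+ 2.
    rewrite /g evB ev1 ev_sum; congr (_ - _); rewrite big_split_ord /= -[RHS]big_split /=.
    apply: eq_bigr => j _; rewrite evM evB evD evZ.
    by rewrite -subr_sqr exprMn sqr_i mulN1r opprK.
  rewrite rmorphB rmorph1 opprB addrC subrKA /sin2sum rmorph_sum distrC -sumrB.
  apply: le_trans (ler_norm_sum _ _ _) _.
  rewrite mulr_natl -[X in _ *+ X]card_ord -sumr_const rmorph_sum.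
  by apply: ler_sum => i _; apply: norm_sqr_sub_le => //; exact: sin_max.
exists (row_mx (\row_j f j) (const_mx g)).
  exists (row_mx (\row_j y j) (const_mx 1)); rewrite big_split_ord big_ord1 /=.
  rewrite !row_mxEr !mxE mul1r /g addrC.
  under eq_bigr do rewrite !row_mxEl !mxE.
  by rewrite subrK.
rewrite /reducible row_mxKl row_mxKr => -[a ainv].
have [d d0 dlow] := invertible_lower_bound ainv.
have [ra raE] := choice (fun j => let: ex_intro2 r r0 E := normE (a 0 j) in
  ex_intro (fun r : R => 0 <= r /\ `|a 0 j| = r%:C) r (conj r0 E)).
pose K := \sum_j ra j.
have K0 : 0 <= K by apply: sumr_ge0 => j _; have [] := raE j.
have aK x j : `|ev x (a 0 j)| <= K%:C.
  apply: le_trans (norm_ev x _) _; rewrite (raE j).2 lecR /K (bigD1 j) //= lerDl.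
  by apply: sumr_ge0 => i _; have [] := raE i.
(* The first bound keeps [sin2sum] at most 1/2 when all [sinC] are below [eta]; the second serves
   the comparison with [d]. *)
pose eta := Num.min (4 * n%:R)^-1 (d / (4 * n%:R)).
have n4 : 0 < 4 * n%:R :> R by rewrite mulr_gt0.
have eta0 : 0 < eta by rewrite lt_min invr_gt0 n4 divr_gt0.
have [ah [L [L0 ahL ahP]]] := SP n (fun j => a 0 j) eta eta0.
pose K' := K + eta.
have K'0 : 0 <= K' by rewrite addr_ge0 // ltW.
have ahK j theta : `|ah j theta| <= K'%:C.
  have [x [_ ax]] := ahP theta 1 ltr01.
  rewrite -[ah j theta](subrK (ev x (a 0 j))); apply: le_trans (ler_normD _ _) _.
  by rewrite /K' rmorphD addrC lerD // distrC ltW.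
(* The model of [f j + a 0 j * g], with [1 - sin2sum] replaced by its positive part so that it
   equals [sinC] on the faces. *)
pose G j theta := sinC j theta + ah j theta * (cutoff theta)%:C.
have normR (r : R) : `|r%:C| = `|r|%:C :> C.
  by rewrite normc_def /= expr0n addr0 sqrtr_sqr.
pose LG := 2 + (L + K' * ((n + n)%:R * 2)).
have LG0 : 0 <= LG by rewrite !addr_ge0 // !mulr_ge0.
have GL j theta theta' (b : R) : (forall i, `|theta i - theta' i| <= b) ->
    `|G j theta - G j theta'| <= (LG * b)%:C.
  move=> dist; rewrite /LG /G opprD addrACA mulrDl rmorphD.
  apply: le_trans (ler_normD _ _) _; apply: lerD; first exact: lipschitz_sinC.
  rewrite -(subrKA (ah j theta' * (cutoff theta)%:C)) -mulrBl -mulrBr.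
  rewrite [in X in _ <= X]mulrDl [X in _ <= X]rmorphD.
  apply: le_trans (ler_normD _ _) _; rewrite !normrM -rmorphB !normR; apply: lerD.
    rewrite -[X in _ <= X]mulr1.
    apply: ler_pM; [exact: normr_ge0|by rewrite ler0c|exact: ahL|].
    by rewrite -[X in _ <= X]/(1%:C) lecR ger0_norm ?cutoff_ge0 ?cutoff_le1.
  rewrite -!mulrA rmorphM; apply: ler_pM; [exact: normr_ge0|by rewrite ler0c|exact: ahK|].
  by rewrite lecR; exact: lipschitz_cutoff.
have Gface theta : half_torus theta -> (exists i, sin (theta i) ^+ 2 = 1) ->
    forall j, `|G j theta - sinC j theta| < 1.
  move=> _ [i si] j; rewrite /G addrC addKr /cutoff max_r ?mulr0 ?normr0 ?ltr01 //.
  by rewrite subr_le0 /sin2sum (bigD1 i) //= si lerDl sumr_ge0 // => l _; rewrite sqr_ge0.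
have [theta _ Gsmall] := torus_zero LG0 GL Gface eta0.
(* Where the cutoff vanishes, small [G] means small [sinC], which is impossible for
   [1 <= sin2sum theta]. Elsewhere the cutoff is the true limit of [g], and the tuple itself becomes
   small. *)
have [rho1|rho1] := lerP 1 (sin2sum theta).
  have Gs j : `|sinC j theta| < eta%:C.
    by have := Gsmall j; rewrite /G /cutoff max_r ?mulr0 ?addr0 // subr_le0.
  have sin_small i : sin (theta i) ^+ 2 <= eta.
    have : `|sin (theta i)| <= eta.
      rewrite -lecR -(splitK i); case: fintype.split => j /=;
        apply: le_trans (ltW (Gs j)).
        exact: (normc_ge_Re (sinC j theta)).
      exact: (norm_Im_le (sinC j theta)).
    apply: le_trans; rewrite -real_normK ?num_real // expr2 ler_piMl ?sin_max //.
  have : sin2sum theta <= (n + n)%:R * eta.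
    rewrite mulr_natl -[X in _ *+ X]card_ord -sumr_const.
    by apply: ler_sum => i _; exact: sin_small.
  have : (n + n)%:R * eta <= 2^-1.
    apply: (@le_trans _ _ ((n + n)%:R * (4 * n%:R)^-1)).
      by rewrite ler_wpM2l // /eta ge_min lexx.
    by rewrite natrD le_eqVlt; apply/orP; left; apply/eqP; field; rewrite gt_eqF.
  move: rho1; clear; lra.
pose e := Num.min 1 (d / (4 * n%:R * (2 + K * ((n + n)%:R * 3)))).
have e0 : 0 < e.
  by rewrite lt_min ltr01 divr_gt0 // mulr_gt0 // ltr_wpDr // !mulr_ge0.
have e1 : e <= 1 by rewrite /e ge_min lexx.
have [x [Sx ax]] := ahP theta e e0.
have := dlow x; apply/negP; rewrite -real_ltNge ?realE ?ler0c ?(ltW d0) ?sumr_ge0 //.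
(* The errors come from the zero of [G], from [f] against [sinC], from [g] against its limit, and
   from [a] against [ah]; n times [b] is at most 3d/4. *)
pose b := eta + (2 * e + (K * ((n + n)%:R * (3 * e)) + eta)).
apply: (@le_lt_trans _ _ (\sum_(j < n) b%:C)).
  apply: ler_sum => j _.
  rewrite [X in ev x X](_ : _ = f j + a 0 j * g); last by rewrite !mxE.
  have cutE : cutoff theta = 1 - sin2sum theta by rewrite /cutoff max_l // subr_ge0 ltW.
  have -> : ev x (f j + a 0 j * g) = G j theta + ((ev x (f j) - sinC j theta) +
      (ev x (a 0 j) * (ev x g - (1 - sin2sum theta)%:C) +
       (ev x (a 0 j) - ah j theta) * (cutoff theta)%:C)).
    by rewrite evD evM /G cutE; ring.
  rewrite /b [X in _ <= X]rmorphD; apply: le_trans (ler_normD _ _) _.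
  apply: lerD; first exact: ltW.
  rewrite [X in _ <= X]rmorphD; apply: le_trans (ler_normD _ _) _.
  apply: lerD; first exact: sinC_near.
  rewrite [X in _ <= X]rmorphD; apply: le_trans (ler_normD _ _) _.
  rewrite !normrM; apply: lerD.
    rewrite [X in _ <= X]rmorphM.
    by apply: ler_pM; [exact: normr_ge0|exact: normr_ge0|exact: aK|exact: g_near].
  rewrite normR -[X in _ <= X]mulr1.
  apply: ler_pM; [exact: normr_ge0|by rewrite ler0c|exact: ltW|].
  by rewrite -[X in _ <= X]/(1%:C) lecR ger0_norm ?cutoff_ge0 ?cutoff_le1.
rewrite -rmorph_sum sumr_const card_ord ltcR -[X in X < _]mulr_natr.
have eta_d : eta <= d / (4 * n%:R) by rewrite /eta ge_min lexx orbT.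
have e_d : e * (4 * n%:R * (2 + K * ((n + n)%:R * 3))) <= d.
  rewrite -ler_pdivlMr; first by rewrite /e ge_min lexx orbT.
  by rewrite mulr_gt0 // ltr_wpDr // !mulr_ge0.
rewrite ler_pdivlMr // in eta_d.
rewrite /b; move: eta_d e_d d0; clear; move: (eta) (e) (K) => u v k; rewrite natrD.
have -> : (u + (2 * v + (k * ((n%:R + n%:R) * (3 * v)) + u))) * n%:R =
  (2 * (u * (4 * n%:R)) + v * (4 * n%:R * (2 + k * ((n%:R + n%:R) * 3)))) / 4 by field.
lra.
Qed.

End AlmostPeriodic.

Lemma least_or_infty_oo (P : nat -> Prop) : (forall n, ~ P n) -> least_or_infty P = +oo%E.
Proof.
move=> nP; rewrite /least_or_infty; case: pselect => // -[n Pn].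
by case: (nP n); apply/asboolP.
Qed.

(** * The real line and the upper half-plane *)

Section Embeddings.
Variable R : realType.
Local Notation C := R[i].

Lemma cexp_horizontal (mu t y : R) :
  cexp ('i * mu%:C * (t +i* y)) = (expR (- (mu * y)))%:C * expi (mu * t).
Proof.
rewrite /expi -mulrA (_ : mu%:C * (t +i* y) = (mu * t) +i* (mu * y)); last by simpc.
have -> : 'i * (mu * t +i* (mu * y)) = (- (mu * y))%:C + 'i * (mu * t)%:C by simpc.
rewrite cexpD; congr (_ * _).
by rewrite /cexp /= cos0 sin0 mulr1.
Qed.

Lemma real_dense (s : seq R) (t e : R) : {in s, forall mu : R, 0 <= mu} -> 0 < e ->
  exists x : R, forall mu, mu \in s ->
  `|cexp ('i * mu%:C * x%:C) - expi (mu * t)| < e%:C.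
Proof.
move=> _ e0; exists t => mu _.
by rewrite cexp_horizontal mulr0 oppr0 expR0 mul1r subrr normr0 ltcR.
Qed.

(** At height [y] the exponential of frequency [mu] shrinks by a factor within [mu * y] of 1;
    dividing [e] by 1 plus the sum of the frequencies handles all of them at once. *)
Lemma Cplus_dense (s : seq R) (t e : R) : {in s, forall mu : R, 0 <= mu} -> 0 < e ->
  exists z : Cplus R, forall mu, mu \in s ->
  `|cexp ('i * mu%:C * set_val z) - expi (mu * t)| < e%:C.
Proof.
move=> s0 e0; pose T := \sum_(mu <- s) mu.
have T0 : 0 <= T by rewrite /T big_seq sumr_ge0.
pose y := e / (1 + T).
have y0 : 0 < y by rewrite divr_gt0 // ltr_wpDr.
have zP : (t +i* y) \in [set z : R[i] | 0 < complex.Im z] by rewrite inE.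
exists (exist _ (t +i* y) zP : Cplus R) => mu mus.
rewrite -[set_val _]/(t +i* y) cexp_horizontal.
rewrite -[X in _ - X]mul1r -mulrBl normrM norm_expi mulr1.
have my0 : 0 <= mu * y by rewrite mulr_ge0 ?(s0 _ mus) ?(ltW y0).
rewrite -(rmorph1 (real_complex R)) -rmorphB normc_def /= expr0n addr0 sqrtr_sqr ltcR.
have muT : mu <= T.
  by rewrite /T (big_rem mu) //= lerDl big_seq sumr_ge0 // => x /mem_rem/s0.
have muye : mu * y < e.
  rewrite /y mulrCA gtr_pMr // ltr_pdivrMr ?ltr_wpDr // mul1r.
  by apply: le_lt_trans muT _; rewrite ltrDr.
have := expR_ge1Dx (- (mu * y)); have : expR (- (mu * y)) <= 1.
  by rewrite -expR0 ler_expR oppr_le0.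
by move=> H1 H2; rewrite ler0_norm ?subr_le0 //; move: H2 muye; clear; lra.
Qed.

Lemma continuous_Cplus_val : continuous (fun z : Cplus R => set_val z : C).
Proof. exact: initial_continuous. Qed.

End Embeddings.

Theorem theorem4p5 (R : realType) :
  [/\ bsr (APplus R) = +oo%E, tsr (APplus R) = +oo%E,
      bsr (APplus_hol R) = +oo%E & tsr (APplus_hol R) = +oo%E].
Proof.
have real_cont : continuous (fun t : R => t%:C : R[i]) by exact: continuous_real_complex.
have real_ge0 (t : R) : 0 <= complex.Im t%:C by [].
have hol_ge0 (z : Cplus R) : 0 <= complex.Im (set_val z : R[i]).
  exact: ltW (set_valP z).
split; apply: least_or_infty_oo => n [n0].
- have [h hinv hred] := exists_irreducible_tuple real_cont real_ge0 (@real_dense R) n0.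
  by move=> /(_ h hinv).
- exact: (not_dense_invertible_tuples real_cont real_ge0 (@real_dense R) n0).
- have [h hinv hred] :=
    exists_irreducible_tuple (@continuous_Cplus_val R) hol_ge0 (@Cplus_dense R) n0.
  by move=> /(_ h hinv).
- exact: (not_dense_invertible_tuples (@continuous_Cplus_val R) hol_ge0 (@Cplus_dense R) n0).
Qed.
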